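(* $$H_{W,V}(\mathbb{T})=\Big\{f\in L^{2}_{V}(\mathbb{T}):\ f=\alpha_{0}+\sum_{i=1}^{\infty}\alpha_{i}\nu_{i},\ \ \sum_{i=1}^{\infty}\lambda_{i}\alpha_{i}^2<\infty\Big\},$$ where $\alpha_0,\alpha_1,\alpha_2,\ldots\in\mathbb{R}$ and $(\nu_i)_{i\ge1}$, $(\lambda_i)_{i\ge 1}$ are the orthonormal non-constant eigenfunctions and corresponding eigenvalues of $-\Delta_{W,V}$.
   Context: Setting. $\mathbb{T}=\mathbb{R}/\mathbb{Z}$, identified with $[0,1)$ with tagged point $0$. Càdlàg = right-continuous with left limits; càglàd = left-continuous with right limits. $W,V:\mathbb{R}\to\mathbb{R}$ are strictly increasing, $W$ càdlàg, $V$ càglàd, with $W(x+1)-W(x)=W(1)-W(0)$ and $V(x+1)-V(x)=V(1)-V(0)$ for all $x$; both are continuous at $0$ and $W(0)=V(0)=0$. They induce finite Borel measures on $\mathbb{T}$ with $dW((a,b])=W(b)-W(a)$, $dV([a,b))=V(b)-V(a)$ (atoms allowed). $L^2_V,L^2_W$ are the corresponding $L^2$ spaces with norms $\|\cdot\|_V,\|\cdot\|_W$; subscript $0$ denotes the mean-zero subspaces. One-sided derivatives: $D_W^-f(x)=\lim_{h\to0^-}\frac{f(x+h)-f(x)}{W(x+h)-W(x)}$, $D_V^+g(x)=\lim_{h\to0^+}\frac{g(x+h)-g(x)}{V(x+h)-V(x)}$, required to exist at every $x\in\mathbb{T}$. $\mathfrak{D}_{W,V}(\mathbb{T})$ is the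 set of càdlàg $f:\mathbb{T}\to\mathbb{R}$ such that $D_W^-f$ exists and is càglàd and $D_V^+D_W^-f$ exists and is càdlàg. On it put $\|f\|_{1,2}^2=\langle f-D_V^+D_W^-f,f\rangle_V=\|f\|_V^2+\|D_W^-f\|_W^2$. $H_{W,V}(\mathbb{T})$ is the set of $f\in L^2_V(\mathbb{T})$ for which there is a sequence $f_n\in\mathfrak{D}_{W,V}(\mathbb{T})$ with $f_n\to f$ in $L^2_V(\mathbb{T})$ and $(f_n)$ Cauchy for $\|\cdot\|_{1,2}$. Laplacian (it equals $I-\mathcal{A}$, $\mathcal{A}$ the Friedrichs extension of $I-D_V^+D_W^-$ from $\mathfrak{D}_{W,V}(\mathbb{T})$): its domain $\mathcal{D}_{W,V}(\mathbb{T})$ is the set of $f\in L^2_V(\mathbb{T})$ with $f(x)=a+bW(x)+\int_{(0,x]}\int_{[0,y)}\mathfrak{f}(s)\,dV(s)\,dW(y)$ $V$-a.e. for some $a,b\in\mathbb{R}$, $\mathfrak{f}\in L^2_{V,0}(\mathbb{T})$ with $bW(1)+\int_{(0,1]}\int_{[0,y)}\mathfrak{f}\,dV\,dW(y)=0$; then $\Delta_{W,V}f=\mathfrak{f}$. Since $I-\Delta_{W,V}$ has compact resolvent, $L^2_V(\mathbb{T})$ has an orthonormal basis $(\nu_i)_{i\ge0}$ of eigenfunctions, $-\Delta_{W,V}\nu_i=\lambda_i\nu_i$, $0=\lambda_0\le\lambda_1\le\lambda_2\le\cdots\to\infty$, with $\nu_0$ constant and $\lambda_i$ listed with multiplicity.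 *)

(* Defs.v *)
From HB Require Import structures.
From mathcomp Require Import all_boot all_order all_algebra.
From mathcomp Require Import all_classical all_reals all_analysis.
Import Order.TTheory GRing.Theory Num.Theory.
Import numFieldTopology.Exports numFieldNormedType.Exports.

Set Implicit Arguments.
Unset Strict Implicit.
Unset Printing Implicit Defensive.

Local Open Scope classical_set_scope.
Local Open Scope ring_scope.

(* The torus R/Z is identified with [0, 1): functions
   on it that are evaluated pointwise are 1-periodic functions on the line,
   and elements of L^2 are represented by functions on the line whose values
   outside [0, 1) are irrelevant. *)

Definition cadlag (R : realType) (f : R -> R) : Prop :=
  forall x, f @ x^'+ --> f x /\ cvg (f @ x^'-).

Definition caglad (R : realType) (f : R -> R) : Prop :=
  forall x, f @ x^'- --> f x /\ cvg (f @ x^'+).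

Definition periodic_increments (R : realType) (F : R -> R) : Prop :=
  forall x, F (x + 1) - F x = F 1 - F 0.

Definition dquot (R : realType) (F f : R -> R) (x h : R) : R :=
  (f (x + h) - f x) / (F (x + h) - F x).

(* Where the one-sided limit does not exist, lim returns an unspecified value;
   existence at every point is required in frakD. *)
Definition dminus (R : realType) (W f : R -> R) (x : R) : R :=
  lim (dquot W f x h @[h --> 0^'-]).

Definition dplus (R : realType) (V g : R -> R) (x : R) : R :=
  lim (dquot V g x h @[h --> 0^'+]).

Definition frakD (R : realType) (W V : R -> R) : set (R -> R) :=
  [set f | [/\ (forall x, f (x + 1) = f x),
               cadlag f,
               (forall x, cvg (dquot W f x h @[h --> 0^'-])) /\
                 caglad (dminus W f) &
               (forall x, cvg (dquot V (dminus W f) x h @[h --> 0^'+])) /\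
                 cadlag (dplus V (dminus W f))]].

(* Turns a measure on the line into the measure it induces on the torus. *)
Definition restrT (R : realType) (mu : {measure set R -> \bar R}) :
    {measure set R -> \bar R} :=
  mrestr mu (measurable_itv `[(0 : R), 1[).

Definition L2T (R : realType) (mu : {measure set R -> \bar R}) :
    set (R -> R) :=
  [set f | f \in Lfun (restrT mu) 2%:E].

Definition innerT (R : realType) (mu : {measure set R -> \bar R})
    (f g : R -> R) : R :=
  \int[restrT mu]_x (f x * g x).

Definition L2T_cvg (R : realType) (mu : {measure set R -> \bar R})
    (f_ : nat -> R -> R) (f : R -> R) : Prop :=
  ('N[restrT mu]_2%:E[EFin \o (f_ n \- f)%R])%E @[n --> \oo] --> 0%E.

(* <f - D_V^+ D_W^- f, f>_V is nonnegative for f in frakD W V. *)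
Definition norm12 (R : realType) (W V : R -> R)
    (dV : {measure set R -> \bar R}) (f : R -> R) : R :=
  Num.sqrt (innerT dV (f \- dplus V (dminus W f)) f).

Definition cauchy12 (R : realType) (W V : R -> R)
    (dV : {measure set R -> \bar R}) (f_ : nat -> R -> R) : Prop :=
  forall e : R, 0 < e -> exists N : nat, forall m n : nat,
    (N <= m)%N -> (N <= n)%N -> norm12 W V dV (f_ m \- f_ n) < e.

Definition HWV (R : realType) (W V : R -> R)
    (dV : {measure set R -> \bar R}) : set (R -> R) :=
  [set f | L2T dV f /\
    exists f_ : nat -> R -> R,
      [/\ (forall n, frakD W V (f_ n)), L2T_cvg dV f_ f &
          cauchy12 W V dV f_]].

Definition iterint (R : realType) (dW dV : {measure set R -> \bar R})
    (g : R -> R) (x : R) : R :=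
  \int[dW]_(y in `]0, x]) \int[dV]_(s in `[0, y[) g s.

(* Graph of the Laplacian: f is in the domain and its Laplacian is g.  As L^2
   elements are represented by functions, this is a relation. *)
Definition laplacian (R : realType) (W : R -> R)
    (dW dV : {measure set R -> \bar R}) (f g : R -> R) : Prop :=
  [/\ L2T dV f, L2T dV g, \int[restrT dV]_x g x = 0 &
   exists a b : R,
     b * W 1 + iterint dW dV g 1 = 0 /\
     {ae restrT dV, forall x, f x = a + b * W x + iterint dW dV g x}].

Definition orthonormal_basis (R : realType) (mu : {measure set R -> \bar R})
    (nu : nat -> R -> R) : Prop :=
  [/\ (forall i, L2T mu (nu i)),
      (forall i j, innerT mu (nu i) (nu j) = (i == j)%:R) &
      forall f, L2T mu f -> exists c : nat -> R,
        L2T_cvg mu (fun n x => \sum_(0 <= i < n) c i * nu i x) f].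

Definition laplacian_eigenbasis (R : realType) (W : R -> R)
    (dW dV : {measure set R -> \bar R})
    (nu : nat -> R -> R) (lambda : nat -> R) : Prop :=
  [/\ orthonormal_basis dV nu,
      (forall i, laplacian W dW dV (nu i) (fun x => - lambda i * nu i x)),
      (exists c : R, {ae restrT dV, forall x, nu 0%N x = c}),
      lambda 0%N = 0 &
      {homo lambda : i j / (i <= j)%N >-> i <= j} /\
      lambda @ \oo --> +oo].

(* Main.v *)
(* Every f in frakD is recovered from D_V^+ D_W^- f by integrating twice (a mean
   value argument for one-sided derivatives relative to W and V), so it lies in
   the domain of the Laplacian, and by Fubini the Laplacian is symmetric.  Hence
   Parseval gives ||f||_{1,2}^2 = sum_i (1 + lambda_i) <f, nu_i>^2 on frakD, and
   a || ||_{1,2}-Cauchy sequence converging to f in L^2_V bounds the partial sums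
   of sum_i lambda_i <f, nu_i>^2.  Conversely, the eigenvalue equation
   exhibits a representative of nu_i that belongs to frakD; the partial sums of
   the expansion are then in frakD, and they are Cauchy for || ||_{1,2}
   because lambda_i >= 1 eventually. *)
Require Import Defs.
From HB Require Import structures.
From mathcomp Require Import all_boot all_order all_algebra.
From mathcomp Require Import all_classical all_reals all_analysis.
From mathcomp Require Import measurable_realfun ring lra.
Import Order.TTheory GRing.Theory Num.Theory.
Import numFieldTopology.Exports numFieldNormedType.Exports.

Set Implicit Arguments.
Unset Strict Implicit.
Unset Printing Implicit Defensive.

Local Open Scope classical_set_scope.
Local Open Scope ring_scope.

(** * One-sided limits *)

Section one_sided.
Context {R : realType}.
Implicit Types (f W : R -> R) (a b x y z : R).

(** What survives is one-sided: the left quotient in [W] compares values across [(y, x]], which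
    contains the atom at [x], so the limit weighs that atom by the value at [x]; symmetrically for
    [V] and [[x, y)]. Uniqueness of primitives is then a real induction along an interval: the
    derivative gives the step in the direction in which it looks, and continuity from the other side
    passes to the limit point. Only increment estimates of integrals enter this argument, so it is
    kept free of measure theory.

    The second obstacle is that an eigenfunction is just an L^2 class while [frakD] asks for
    derivatives at every point. Regularity returns through the integral formula because the inner
    integral ignores [dV]-null sets.

    The quadratic form behind [norm12] is never expanded into ||f||_V^2 + ||D_W^- f||_W^2. Its value
    comes from Parseval and symmetry, and its positivity from [lambda i >= 0], which follows from
    [lambda 0 = 0] and monotonicity. *)

Lemma at_right_exP x (P : R -> Prop) :
  (\forall y \near x^'+, P y) <-> exists2 z, x < z & forall y, x < y < z -> P y.
Proof.
split=> [|[z xz xzP]].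
- case=> e /= e0 eP; exists (x + e) => [|y /andP[xy ye]]; first by rewrite ltrDl.
  by apply: eP => //=; rewrite ltr0_norm ?subr_lt0// opprB ltrBlDl.
- near=> y; apply: xzP; apply/andP; split; near: y.
    exact: nbhs_right_gt.
  exact: nbhs_right_lt.
Unshelve. all: by end_near. Qed.

Lemma at_left_exP x (P : R -> Prop) :
  (\forall y \near x^'-, P y) <-> exists2 z, z < x & forall y, z < y < x -> P y.
Proof.
split=> [|[z xz xzP]].
- case=> e /= e0 eP; exists (x - e) => [|y /andP[ye xy]]; first by rewrite ltrBlDl ltrDr.
  by apply: eP => //=; rewrite gtr0_norm ?subr_gt0// ltrBlDl -ltrBlDr.
- near=> y; apply: xzP; apply/andP; split; near: y.
    exact: nbhs_left_gt.
  exact: nbhs_left_lt.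
Unshelve. all: by end_near. Qed.

(** Real induction run downwards from [b]. The supremum of the counterexamples satisfies [P] by the
    last hypothesis, hence so does a left neighbourhood of it by the step, which contradicts its
    being the supremum. *)
Lemma real_ind_left a b (P : R -> Prop) : P b ->
  (forall x, a < x <= b -> (forall y, x <= y <= b -> P y) ->
    \forall y \near x^'-, P y) ->
  (forall x, a <= x < b -> (forall y, x < y <= b -> P y) -> P x) ->
  forall x, a <= x <= b -> P x.
Proof.
move=> Pb step lim x0 x0ab; apply: contrapT => nPx0.
pose S := [set x | a <= x <= b /\ ~ P x].
have Sx0 : S x0 by split.
have S0 : S !=set0 by exists x0.
have ubS : has_ubound S by exists b => y [/andP[]].
have sup_ub y : S y -> y <= sup S by apply: ub_le_sup.
have as_ : a <= sup S.
  by apply: le_trans (sup_ub _ Sx0); case/andP: x0ab.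
have sb : sup S <= b by apply: ge_sup => // y [/andP[]].
have Pr y : sup S < y <= b -> P y.
  move=> /andP[sy yb]; apply: contrapT => nPy.
  have : y <= sup S by apply: sup_ub; split => //; rewrite (le_trans as_ (ltW sy)).
  by rewrite leNgt sy.
have Ps : P (sup S).
  have := sb; rewrite le_eqVlt => /predU1P[->//|sltb].
  by apply: lim Pr; rewrite as_.
have Pr' y : sup S <= y <= b -> P y.
  rewrite le_eqVlt => /andP[/predU1P[<-//|sy] yb]; apply: Pr.
  by rewrite sy.
have alts : a < sup S.
  apply: (le_lt_trans _ (_ : x0 < sup S)); first by case/andP: x0ab.
  rewrite lt_neqAle sup_ub// andbT; apply: contra_notN nPx0 => /eqP ->.
  exact: Ps.
have /at_left_exP[z zs zP] : \forall y \near (sup S)^'-, P y.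
  by apply: step Pr'; rewrite alts.
have : sup S <= z.
  apply: ge_sup => // y [/andP[ay yb] nPy]; rewrite leNgt; apply/negP => zy.
  apply: nPy; have [ys|sy] := ltP y (sup S); first by apply: zP; rewrite zy.
  by apply: Pr'; rewrite sy.
by rewrite leNgt zs.
Qed.

(** Substitute for the mean value theorem: for each [e] the bound |f b - f y| <= e (W b - W y)
    propagates from [b] down to [a]. The left estimate gives the step, and right continuity of [f]
    and [W] passes the bound to the limit point; then [e] tends to 0. *)
Lemma left_null_cst W f a b : a <= b ->
  (forall x, a <= x < b -> W @ x^'+ --> W x) ->
  (forall x, a <= x < b -> f @ x^'+ --> f x) ->
  (forall x, a < x <= b -> forall e, 0 < e ->
    \forall y \near x^'-, `|f x - f y| <= e * (W x - W y)) ->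
  f a = f b.
Proof.
move=> ab Wr fr fl.
suff H e : 0 < e -> `|f b - f a| <= e * (W b - W a).
  apply/eqP; rewrite eq_sym -subr_eq0 -normr_le0; apply/ler_addgt0Pl => e e0.
  (* [W] is not assumed monotone here; if the increment is nonpositive, the bound with [e = 1]
     already suffices. *)
  rewrite addr0; have [D0|D0] := leP (W b - W a) 0.
    apply: le_trans (H 1 ltr01) _; rewrite mul1r (le_trans D0)// ltW//.
  by rewrite (le_trans (H (e / (W b - W a)) _)) ?divr_gt0// divfK// gt_eqF.
move=> e0.
apply: (@real_ind_left a b (fun y => `|f b - f y| <= e * (W b - W y))).
- by rewrite !subrr normr0 mulr0.
- move=> x xab Px.
  apply: filterS (fl x xab e e0) => y fxy.
  have -> : f b - f y = (f b - f x) + (f x - f y) by ring.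
  apply: le_trans (ler_normD _ _) _.
  have -> : e * (W b - W y) = e * (W b - W x) + e * (W x - W y) by ring.
  by apply: lerD fxy; apply: Px; rewrite lexx; case/andP: xab.
- move=> x xab Px.
  have xb : x < b by case/andP: xab.
  apply: (@ler_cvg_to _ x^'+ _ _ (fun y => `|f b - f y|) (fun y => e * (W b - W y))).
  + by apply: cvg_norm; apply: cvgB; [exact: cvg_cst|exact: fr].
  + by apply: cvgMr; apply: cvgB; [exact: cvg_cst|exact: Wr].
  + near=> y; apply: Px; apply/andP; split; near: y.
      exact: nbhs_right_gt.
    exact: nbhs_right_le.
- by rewrite lexx ab.
Unshelve. all: by end_near. Qed.

Lemma right_null_cst W f a b : a <= b ->
  (forall x, a < x <= b -> W @ x^'- --> W x) ->
  (forall x, a < x <= b -> f @ x^'- --> f x) ->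
  (forall x, a <= x < b -> forall e, 0 < e ->
    \forall y \near x^'+, `|f y - f x| <= e * (W y - W x)) ->
  f a = f b.
Proof.
move=> ab Wr fr fl.
have inN x (c d : bool) : [&& (- b < x ?<= if c) & (x < - a ?<= if d)] ->
   [&& (a < - x ?<= if d) & (- x < b ?<= if c)].
  by move=> /andP[h1 h2]; rewrite lteifNr h2 lteifNl h1.
(* Reflection at 0 exchanges left and right; the outer sign on [W] keeps its increments positively
   oriented. *)
have := @left_null_cst (fun x => - W (- x)) (fun x => f (- x)) (- b) (- a).
rewrite !opprK => -> //; first by rewrite lerN2.
- move=> x /(inN x true false) xab; apply: cvgN.
  by rewrite -[x in x^'+]opprK; apply/cvg_at_leftNP/Wr.
- move=> x /(inN x true false) xab.
  by rewrite -[x in x^'+]opprK; apply/cvg_at_leftNP/fr.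
- move=> x /(inN x false true) xab e e0.
  rewrite -[x in x^'-]opprK at_leftN near_simpl.
  apply: filterS (fl _ xab e e0) => y; rewrite /= opprK => h.
  by rewrite -normrN opprB opprK [- _ + _]addrC.
Qed.

(** Real induction on boundedness over [[x, b]]: one-sided limits bound [f] on punctured one-sided
    neighbourhoods. *)
Lemma regulated_bounded f a b :
  (forall x, cvg (f @ x^'+) /\ cvg (f @ x^'-)) ->
  exists M, forall x, a <= x <= b -> `|f x| <= M.
Proof.
move=> fc; have [ab|ba] := leP a b; last first.
  exists 0 => x /andP[ax xb]; have := le_lt_trans (le_trans ax xb) ba.
  by rewrite ltxx.
suff [M HM] : exists M, forall y, a <= y <= b -> `|f y| <= M by exists M.
apply: (@real_ind_left a b (fun x => exists M, forall y, x <= y <= b -> `|f y| <= M)).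
- by exists `|f b| => y; rewrite -eq_le => /eqP ->.
- move=> x /andP[ax xb] /(_ x); rewrite lexx => /(_ xb)[M HM].
  have /cvg_ex[l fl] := (fc x).2.
  have /at_left_exP[z zx zP] : \forall y \near x^'-, `|f y| <= `|l| + 1.
    have /cvgrPdist_le/(_ 1 ltr01) := fl.
    apply: filterS => y; rewrite distrC => h.
    by rewrite -(subrK l (f y)) (le_trans (ler_normD _ _))// addrC lerD2l.
  apply/at_left_exP; exists z => // y /andP[zy yx].
  exists (Num.max M (`|l| + 1)) => w /andP[yw wb].
  rewrite le_max; have [wx|xw] := ltP w x.
    by rewrite zP ?orbT// (lt_le_trans zy yw).
  by rewrite HM// xw.
- move=> x /andP[ax xb] Px.
  have /cvg_ex[l fl] := (fc x).1.
  have /at_right_exP[z zx zP] : \forall y \near x^'+, `|f y| <= `|l| + 1.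
    have /cvgrPdist_le/(_ 1 ltr01) := fl.
    apply: filterS => y; rewrite distrC => h.
    by rewrite -(subrK l (f y)) (le_trans (ler_normD _ _))// addrC lerD2l.
  (* A point of [(x, b]] below [z]: the right limit bounds [f] on [(x, m)], the induction hypothesis
     on [[m, b]]. The value at [x] itself must be added to the maximum, since no limit controls
     it. *)
  pose m := Num.min ((x + z) / 2) b.
  have xm : x < m by rewrite lt_min xb andbT; lra.
  have mz : m < z by rewrite gt_min; apply/orP; left; lra.
  have [|M HM] := Px m; first by rewrite xm ge_min lexx orbT.
  exists (Num.max M (Num.max (`|l| + 1) `|f x|)) => w /andP[].
  rewrite le_eqVlt => /predU1P[<- _|xw wb]; first by rewrite !le_max lexx !orbT.
  rewrite !le_max; have [wm|mw] := ltP w m.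
    by rewrite zP ?orbT// xw (lt_trans wm mz).
  by rewrite HM// mw wb.
- by rewrite lexx ab.
Qed.

Lemma cadlag_bounded f a b : cadlag f ->
  exists M, forall x, a <= x <= b -> `|f x| <= M.
Proof.
move=> cf; apply: regulated_bounded => x; have [fx ?] := cf x; split => //.
by apply/cvg_ex; exists (f x).
Qed.

Lemma caglad_bounded f a b : caglad f ->
  exists M, forall x, a <= x <= b -> `|f x| <= M.
Proof.
move=> cf; apply: regulated_bounded => x; have [fx ?] := cf x; split => //.
by apply/cvg_ex; exists (f x).
Qed.

(** [f] is the pointwise limit of step functions that sample it at (floor(x (n+1)) + 1)/(n+1), a
    point of (x, x + 1/(n+1)], hence approaching [x] strictly from the right. Each step function is
    measurable because it factors through a monotone map with countably many values. *)
Lemma measurable_right_cts f : (forall x, f @ x^'+ --> f x) ->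
  measurable_fun setT f.
Proof.
move=> fr.
pose g (n : nat) (k : int) := f ((k%:~R + 1) / n.+1%:R).
apply: (@measurable_fun_cvg _ _ _ _ (fun n x => g n (Num.floor (x * n.+1%:R)))).
- move=> n _ Y mY; rewrite setTI.
  rewrite (_ : _ @^-1` _ = \bigcup_k (if asbool (Y (g n k)) then
     (fun x => (Num.floor (x * n.+1%:R))%:~R : R) @^-1` [set k%:~R] else set0)).
    apply: countable_bigcupT_measurable => // k; case: ifP => // _.
    rewrite -[X in measurable X]setTI; apply: nondecreasing_measurable => //.
    by move=> x y xy; rewrite ler_int le_floor// ler_wpM2r.
  apply/seteqP; split=> [x Yx|x [k _]].
    by exists (Num.floor (x * n.+1%:R)) => //; rewrite asboolT.
  by case: asboolP => // Yk /= /eqP; rewrite eqr_int => /eqP ->.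
- move=> x _; apply/cvgrPdist_le => e e0.
  have /cvgrPdist_le/(_ _ e0)/at_right_exP[z xz zP] := fr x.
  have zx0 : 0 < z - x by rewrite subr_gt0.
  near=> n; apply: zP.
  have n0 : (0 : R) < n.+1%:R by [].
  have /andP[h1 h2] := floor_itv (x * n.+1%:R).
  rewrite intrD in h2.
  rewrite ltr_pdivlMr// h2 /= ltr_pdivrMr//.
  apply: le_lt_trans (_ : x * n.+1%:R + 1 < _); first by rewrite lerD2r.
  rewrite -ltrBrDl -mulrBl -ltr_pdivrMr// div1r.
  near: n; exact: (near_infty_natSinv_lt (PosNum zx0)).
Unshelve. all: by end_near. Qed.

Lemma measurable_left_cts f : (forall x, f @ x^'- --> f x) ->
  measurable_fun setT f.
Proof.
move=> fl; rewrite (_ : f = (f \o -%R) \o -%R); last first.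
  by apply/funext => x /=; rewrite opprK.
apply: measurableT_comp; last exact: measurable_funN.
apply: measurable_right_cts => x /=.
by rewrite -[x in x^'+]opprK; apply/cvg_at_leftNP/fl.
Qed.

End one_sided.

(** * One-sided derivatives and primitives *)

Section primitives.
Context {R : realType}.
Implicit Types (f g F G W V I K : R -> R) (x y z l c e : R).

(* I is an integral of F against dW over half-open intervals (y, z]; only the
   resulting estimate on increments is recorded. *)
Definition left_primitive W F I := forall y z, 0 <= y -> y <= z -> z <= 1 ->
  forall c e, (forall s, y < s <= z -> `|F s - c| <= e) ->
  `|I z - I y - c * (W z - W y)| <= e * (W z - W y).

Definition right_primitive V G K := forall y z, 0 <= y -> y <= z -> z <= 1 ->
  forall c e, (forall s, y <= s < z -> `|G s - c| <= e) ->
  `|K z - K y - c * (V z - V y)| <= e * (V z - V y).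

Lemma cvg_at_left0D (f : R -> R) (g : R -> R) x l :
  (forall h, g h = f (x + h)) ->
  (g h @[h --> 0^'-] --> l) <-> (f @ x^'- --> l).
Proof.
move=> gE; split=> h.
- apply/cvgrPdist_le => e e0; move/cvgrPdist_le/(_ e e0)/at_left_exP : h => [z z0 zP].
  apply/at_left_exP; exists (x + z) => [|y /andP[zy yx]]; first by lra.
  by have := zP (y - x); rewrite gE subrKC; apply; lra.
- apply/cvgrPdist_le => e e0; move/cvgrPdist_le/(_ e e0)/at_left_exP : h => [z z0 zP].
  apply/at_left_exP; exists (z - x) => [|y /andP[zy yx]]; first by lra.
  by rewrite gE; apply: zP; lra.
Qed.

Lemma cvg_at_right0D (f : R -> R) (g : R -> R) x l :
  (forall h, g h = f (x + h)) ->
  (g h @[h --> 0^'+] --> l) <-> (f @ x^'+ --> l).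
Proof.
move=> gE; split=> h.
- apply/cvgrPdist_le => e e0; move/cvgrPdist_le/(_ e e0)/at_right_exP : h => [z z0 zP].
  apply/at_right_exP; exists (x + z) => [|y /andP[zy yx]]; first by lra.
  by have := zP (y - x); rewrite gE subrKC; apply; lra.
- apply/cvgrPdist_le => e e0; move/cvgrPdist_le/(_ e e0)/at_right_exP : h => [z z0 zP].
  apply/at_right_exP; exists (z - x) => [|y /andP[zy yx]]; first by lra.
  by rewrite gE; apply: zP; lra.
Qed.

(** Clears the positive denominator. In this form the estimates for two functions can be subtracted
    and fed to [left_null_cst]. *)
Lemma dquot_leftP W f x l : {homo W : x y / x < y} ->
  (dquot W f x h @[h --> 0^'-] --> l) <->
  (forall e, 0 < e -> \forall y \near x^'-,
     `|f x - f y - l * (W x - W y)| <= e * (W x - W y)).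
Proof.
move=> Wi; rewrite (@cvg_at_left0D (fun y => (f y - f x) / (W y - W x)))//.
have E y : y < x -> f x - f y - l * (W x - W y) =
    ((f y - f x) / (W y - W x) - l) * (W x - W y).
  move=> /Wi yx; have : W y - W x != 0 by rewrite lt_eqF// subr_lt0.
  by move=> ?; field.
split=> [/cvgrPdist_le h e /h|h]; last apply/cvgrPdist_le => e /h.
- move=> /at_left_exP[z zx zP]; apply/at_left_exP; exists z => // y zyx.
  have yx : y < x by case/andP: zyx.
  have Wyx := Wi _ _ yx.
  by rewrite E// normrM distrC [X in _ * X]gtr0_norm ?subr_gt0// ler_pM2r ?subr_gt0// zP.
- move=> /at_left_exP[z zx zP]; apply/at_left_exP; exists z => // y zyx.
  have yx : y < x by case/andP: zyx.
  have Wyx := Wi _ _ yx.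
  have := zP y zyx.
  by rewrite E// normrM distrC [X in _ * X]gtr0_norm ?subr_gt0// ler_pM2r ?subr_gt0.
Qed.

Lemma dquot_rightP V f x l : {homo V : x y / x < y} ->
  (dquot V f x h @[h --> 0^'+] --> l) <->
  (forall e, 0 < e -> \forall y \near x^'+,
     `|f y - f x - l * (V y - V x)| <= e * (V y - V x)).
Proof.
move=> Vi; rewrite (@cvg_at_right0D (fun y => (f y - f x) / (V y - V x)))//.
have E y : x < y -> f y - f x - l * (V y - V x) =
    ((f y - f x) / (V y - V x) - l) * (V y - V x).
  move=> /Vi yx; have : V y - V x != 0 by rewrite gt_eqF// subr_gt0.
  by move=> ?; field.
split=> [/cvgrPdist_le h e /h|h]; last apply/cvgrPdist_le => e /h.
- move=> /at_right_exP[z zx zP]; apply/at_right_exP; exists z => // y zyx.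
  have yx : x < y by case/andP: zyx.
  have Vyx := Vi _ _ yx.
  by rewrite E// normrM distrC [X in _ * X]gtr0_norm ?subr_gt0// ler_pM2r ?subr_gt0// zP.
- move=> /at_right_exP[z zx zP]; apply/at_right_exP; exists z => // y zyx.
  have yx : x < y by case/andP: zyx.
  have Vyx := Vi _ _ yx.
  have := zP y zyx.
  by rewrite E// normrM distrC [X in _ * X]gtr0_norm ?subr_gt0// ler_pM2r ?subr_gt0.
Qed.

(** Left continuity keeps [F] close to [F x] on all of [(y, x]]; at the endpoint [x], where [W] may
    have an atom, the deviation is exactly 0. *)
Lemma left_primitive_derive W F I x : left_primitive W F I ->
  0 < x <= 1 -> F @ x^'- --> F x ->
  forall e, 0 < e -> \forall y \near x^'-,
     `|I x - I y - F x * (W x - W y)| <= e * (W x - W y).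
Proof.
move=> pI /andP[x0 x1] Fx e e0.
have /cvgrPdist_le/(_ e e0)/at_left_exP[z zx zP] := Fx.
apply/at_left_exP; exists (Num.max z 0); first by rewrite gt_max zx.
move=> y /andP[]; rewrite gt_max => /andP[zy y0] yx.
apply: pI => //; [exact: ltW|exact: ltW|move=> s /andP[ys]].
rewrite le_eqVlt => /predU1P[->|sx]; first by rewrite subrr normr0 ltW.
by rewrite distrC zP// (lt_trans zy ys).
Qed.

Lemma right_primitive_derive V G K x : right_primitive V G K ->
  0 <= x < 1 -> G @ x^'+ --> G x ->
  forall e, 0 < e -> \forall y \near x^'+,
     `|K y - K x - G x * (V y - V x)| <= e * (V y - V x).
Proof.
move=> pK /andP[x0 x1] Gx e e0.
have /cvgrPdist_le/(_ e e0)/at_right_exP[z zx zP] := Gx.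
apply/at_right_exP; exists (Num.min z 1); first by rewrite lt_min zx.
move=> y /andP[xy]; rewrite lt_min => /andP[yz y1].
apply: pK => //; [exact: ltW|exact: ltW|move=> s /andP[]].
rewrite le_eqVlt => /predU1P[<-|xs sy]; first by rewrite subrr normr0 ltW.
by rewrite distrC zP// xs (lt_trans sy yz).
Qed.

Lemma left_primitive_lip W F I M : left_primitive W F I ->
  (forall x, 0 <= x <= 1 -> `|F x| <= M) ->
  forall y z, 0 <= y -> y <= z -> z <= 1 -> `|I z - I y| <= M * (W z - W y).
Proof.
move=> pI FM y z y0 yz z1; have := pI y z y0 yz z1 0 M.
rewrite mul0r subr0; apply=> s /andP[ys sz]; rewrite subr0 FM//.
by rewrite (le_trans y0 (ltW ys)) (le_trans sz).
Qed.

Lemma right_primitive_lip V G K M : right_primitive V G K ->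
  (forall x, 0 <= x <= 1 -> `|G x| <= M) ->
  forall y z, 0 <= y -> y <= z -> z <= 1 -> `|K z - K y| <= M * (V z - V y).
Proof.
move=> pI FM y z y0 yz z1; have := pI y z y0 yz z1 0 M.
rewrite mul0r subr0; apply=> s /andP[ys sz]; rewrite subr0 FM//.
by rewrite (le_trans y0 ys) (le_trans (ltW sz)).
Qed.

Lemma lip_right_cvg W I M x : (forall y z, 0 <= y -> y <= z -> z <= 1 ->
    `|I z - I y| <= M * (W z - W y)) ->
  0 <= x < 1 -> W @ x^'+ --> W x -> I @ x^'+ --> I x.
Proof.
move=> lip /andP[x0 x1] Wx; apply/cvgrPdist_le => e e0.
have cW : M * (W y - W x) @[y --> x^'+] --> M * (W x - W x).
  by apply: cvgMr; apply: cvgB => //; exact: cvg_cst.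
rewrite subrr mulr0 in cW.
near=> y; rewrite distrC; apply: le_trans (lip x y x0 _ _) _.
- by near: y; exact: nbhs_right_ge.
- by near: y; exact: nbhs_right_le.
- apply: le_trans (ler_norm _) _; rewrite -normrN -sub0r; near: y.
  by move/cvgrPdist_le : cW; apply.
Unshelve. all: by end_near. Qed.

Lemma lip_left_cvg W I M x : (forall y z, 0 <= y -> y <= z -> z <= 1 ->
    `|I z - I y| <= M * (W z - W y)) ->
  0 < x <= 1 -> W @ x^'- --> W x -> I @ x^'- --> I x.
Proof.
move=> lip /andP[x0 x1] Wx; apply/cvgrPdist_le => e e0.
have cW : M * (W x - W y) @[y --> x^'-] --> M * (W x - W x).
  by apply: cvgMr; apply: cvgB => //; exact: cvg_cst.
rewrite subrr mulr0 in cW.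
near=> y; apply: le_trans (lip y x _ _ x1) _.
- by near: y; exact: nbhs_left_ge.
- by near: y; exact: nbhs_left_le.
- apply: le_trans (ler_norm _) _; rewrite -normrN -sub0r; near: y.
  by move/cvgrPdist_le : cW; apply.
Unshelve. all: by end_near. Qed.

(* I + M W is nondecreasing, so it has one-sided limits. *)
Lemma lip_left_is_cvg W I M x : (forall y z, 0 <= y -> y <= z -> z <= 1 ->
    `|I z - I y| <= M * (W z - W y)) ->
  0 < x <= 1 -> cvg (W @ x^'-) -> cvg (I @ x^'-).
Proof.
move=> lip /andP[x0 x1] Wx.
have mono y z : 0 <= y -> y <= z -> z <= 1 -> I y + M * W y <= I z + M * W z.
  by move=> y0 yz z1; have := lip _ _ y0 yz z1; rewrite ler_norml => /andP[]; lra.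
have cIW : cvg ((I y + M * W y) @[y --> x^'-]).
  apply: nondecreasing_at_left_is_cvgr.
  - near=> y => u v; rewrite !in_itv/= => /andP[yu ux] /andP[yv vx] uv.
    apply: mono => //; last by rewrite (le_trans (ltW vx)).
    by rewrite (le_trans _ (ltW yu))//; near: y; exact: nbhs_left_ge.
  - near=> y; exists (I x + M * W x) => _ [u /= + <-].
    rewrite in_itv/= => /andP[yu ux]; apply: mono => //; last exact: ltW.
    by rewrite (le_trans _ (ltW yu))//; near: y; exact: nbhs_left_ge.
rewrite (_ : I = fun y => (I y + M * W y) - M * W y).
  by apply: is_cvgB => //; exact: is_cvgMr.
by apply/funext => y; rewrite addrK.
Unshelve. all: by end_near. Qed.

Lemma lip_right_is_cvg W I M x : (forall y z, 0 <= y -> y <= z -> z <= 1 ->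
    `|I z - I y| <= M * (W z - W y)) ->
  0 <= x < 1 -> cvg (W @ x^'+) -> cvg (I @ x^'+).
Proof.
move=> lip /andP[x0 x1] Wx.
have mono y z : 0 <= y -> y <= z -> z <= 1 -> I y + M * W y <= I z + M * W z.
  by move=> y0 yz z1; have := lip _ _ y0 yz z1; rewrite ler_norml => /andP[]; lra.
have cIW : cvg ((I y + M * W y) @[y --> x^'+]).
  apply: nondecreasing_at_right_is_cvgr.
  - near=> y => u v; rewrite !in_itv/= => /andP[xu uy] /andP[xv vy] uv.
    apply: mono => //; first by rewrite (le_trans x0 (ltW xu)).
    by rewrite (le_trans (ltW vy))//; near: y; exact: nbhs_right_le.
  - near=> y; exists (I x + M * W x) => _ [u /= + <-].
    rewrite in_itv/= => /andP[xu uy]; apply: mono => //; first exact: ltW.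
    by rewrite (le_trans (ltW uy))//; near: y; exact: nbhs_right_le.
rewrite (_ : I = fun y => (I y + M * W y) - M * W y).
  by apply: is_cvgB => //; exact: is_cvgMr.
by apply/funext => y; rewrite addrK.
Unshelve. all: by end_near. Qed.

(** [f] and [I] have the same left derivative [F], so [f - I] satisfies [left_null_cst]. The bound
    [M] serves to transfer right continuity from [W] to [I]. *)
Lemma left_FTC W f F I M : {homo W : x y / x < y} ->
  (forall x, 0 <= x < 1 -> W @ x^'+ --> W x) ->
  (forall x, 0 <= x < 1 -> f @ x^'+ --> f x) ->
  (forall x, 0 < x <= 1 -> dquot W f x h @[h --> 0^'-] --> F x) ->
  (forall x, 0 < x <= 1 -> F @ x^'- --> F x) ->
  (forall x, 0 <= x <= 1 -> `|F x| <= M) ->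
  left_primitive W F I ->
  forall x, 0 <= x <= 1 -> f x - f 0 = I x - I 0.
Proof.
move=> Wi Wr fr fF Fl FM pI x /andP[x0 x1].
have H : f 0 - I 0 = f x - I x.
  apply: (@left_null_cst _ W (fun x => f x - I x)) => //.
  - by move=> y /andP[y0 yx]; apply: Wr; rewrite y0 (lt_le_trans yx).
  - move=> y /andP[y0 yx]; have y01 : 0 <= y < 1 by rewrite y0 (lt_le_trans yx).
    apply: cvgB; first exact: fr.
    exact: lip_right_cvg (left_primitive_lip pI FM) y01 (Wr _ y01).
  - move=> y /andP[y0 yx] e e0.
    have y01 : 0 < y <= 1 by rewrite y0 (le_trans yx).
    have e20 : 0 < e / 2 by rewrite divr_gt0.
    have := (dquot_leftP f y (F y) Wi).1 (fF _ y01) _ e20.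
    have := left_primitive_derive pI y01 (Fl _ y01) e20.
    apply: filterS2 => u hI hf.
    have -> : f y - I y - (f u - I u) = (f y - f u - F y * (W y - W u)) -
      (I y - I u - F y * (W y - W u)) by ring.
    apply: le_trans (ler_normB _ _) _; rewrite [e]splitr mulrDl.
    exact: lerD.
by move: H; lra.
Qed.

Lemma right_FTC V g G K M : {homo V : x y / x < y} ->
  (forall x, 0 < x <= 1 -> V @ x^'- --> V x) ->
  (forall x, 0 < x <= 1 -> g @ x^'- --> g x) ->
  (forall x, 0 <= x < 1 -> dquot V g x h @[h --> 0^'+] --> G x) ->
  (forall x, 0 <= x < 1 -> G @ x^'+ --> G x) ->
  (forall x, 0 <= x <= 1 -> `|G x| <= M) ->
  right_primitive V G K ->
  forall x, 0 <= x <= 1 -> g x - g 0 = K x - K 0.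
Proof.
move=> Vi Vl gl gG Gr GM pK x /andP[x0 x1].
have H : g 0 - K 0 = g x - K x.
  apply: (@right_null_cst _ V (fun x => g x - K x)) => //.
  - by move=> y /andP[y0 yx]; apply: Vl; rewrite y0 (le_trans yx).
  - move=> y /andP[y0 yx]; have y01 : 0 < y <= 1 by rewrite y0 (le_trans yx).
    apply: cvgB; first exact: gl.
    exact: lip_left_cvg (right_primitive_lip pK GM) y01 (Vl _ y01).
  - move=> y /andP[y0 yx] e e0.
    have y01 : 0 <= y < 1 by rewrite y0 (lt_le_trans yx).
    have e20 : 0 < e / 2 by rewrite divr_gt0.
    have := (dquot_rightP g y (G y) Vi).1 (gG _ y01) _ e20.
    have := right_primitive_derive pK y01 (Gr _ y01) e20.
    apply: filterS2 => u hK hg.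
    have -> : g u - K u - (g y - K y) = (g u - g y - G y * (V u - V y)) -
      (K u - K y - G y * (V u - V y)) by ring.
    apply: le_trans (ler_normB _ _) _; rewrite [e]splitr mulrDl.
    exact: lerD.
by move: H; lra.
Qed.

(** The left side is the integral of [F - c]; this is what makes honest integrals satisfy
    [left_primitive] and [right_primitive]. *)
Lemma integral_est (mu : {measure set R -> \bar R}) (D : set R) F c e :
  measurable D -> (mu D < +oo)%E -> measurable_fun setT F ->
  (forall s, D s -> `|F s - c| <= e) ->
  `|\int[mu]_(s in D) F s - c * fine (mu D)| <= e * fine (mu D).
Proof.
move=> mD Doo mF Fc.
have iB G M : measurable_fun setT G -> (forall s, D s -> `|G s| <= M) ->
    mu.-integrable D (EFin \o G).
  move=> mG GM; apply: measurable_bounded_integrable => //.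
    exact: measurable_funTS.
  exists M; split; first exact: num_real.
  by move=> N MN s Ds /=; rewrite (le_trans (GM _ Ds))// ltW.
have iF : mu.-integrable D (EFin \o F).
  apply: (iB _ (`|c| + e)) => // s Ds.
  by rewrite -(subrKC c (F s)) (le_trans (ler_normD _ _))// lerD2l Fc.
have ic r : mu.-integrable D (EFin \o cst r) by apply: (iB _ `|r|).
have mFc : measurable_fun setT (fun s => F s - c).
  exact: measurable_funB.
rewrite -(Rintegral_cst _ mD) -(Rintegral_cst _ mD) -RintegralB//; last exact: ic.
have iFc : mu.-integrable D (EFin \o (fun s => F s - c)) by apply: (iB _ e).
apply: le_trans (le_normr_Rintegral _ _) _ => //.
apply: le_Rintegral => //; last exact: ic.
exact: (integrable_norm iFc).
Qed.

Lemma left_primitive_integral (mu : {measure set R -> \bar R}) W F M :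
  (forall a b : R, a <= b -> mu `]a, b]%classic = (W b - W a)%:E) ->
  measurable_fun setT F -> (forall x, 0 <= x <= 1 -> `|F x| <= M) ->
  left_primitive W F (fun x => \int[mu]_(s in `]0, x]) F s).
Proof.
move=> muE mF FM y z y0 yz z1 c e Fc.
have -> : \int[mu]_(s in `]0, z]) F s - \int[mu]_(s in `]0, y]) F s =
    \int[mu]_(s in `]y, z]) F s.
  rewrite (@itv_bndbnd_setU _ _ (BRight 0) (BRight y) (BRight z)) ?bnd_simp//.
  rewrite Rintegral_setU//=.
  - by rewrite addrC addKr.
  - rewrite -itv_bndbnd_setU ?bnd_simp//.
    apply: measurable_bounded_integrable => //.
    + by rewrite muE ?ltry// (le_trans y0).
    + exact: measurable_funTS.
    + exists M; split; first exact: num_real.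
      move=> N MN s /=; rewrite in_itv/= => /andP[s0 sz] /=.
      by rewrite (le_trans (FM _ _))// ltW// (le_trans sz)// ltW.
  - apply/disj_setPS => s [/=]; rewrite 2!in_itv/= => /andP[_ sy] /andP[].
    by rewrite ltNge sy.
have := @integral_est mu `]y, z]%classic F c e.
rewrite muE// => /=; apply => //; first by rewrite ltry.
Qed.

Lemma right_primitive_integral (mu : {measure set R -> \bar R}) V G M :
  (forall a b : R, a <= b -> mu `[a, b[%classic = (V b - V a)%:E) ->
  measurable_fun setT G -> (forall x, 0 <= x <= 1 -> `|G x| <= M) ->
  right_primitive V G (fun x => \int[mu]_(s in `[0, x[) G s).
Proof.
move=> muE mG GM y z y0 yz z1 c e Gc.
have -> : \int[mu]_(s in `[0, z[) G s - \int[mu]_(s in `[0, y[) G s =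
    \int[mu]_(s in `[y, z[) G s.
  rewrite (@itv_bndbnd_setU _ _ (BLeft 0) (BLeft y) (BLeft z)) ?bnd_simp//.
  rewrite Rintegral_setU//=.
  - by rewrite addrC addKr.
  - rewrite -itv_bndbnd_setU ?bnd_simp//.
    apply: measurable_bounded_integrable => //.
    + by rewrite muE ?ltry// (le_trans y0).
    + exact: measurable_funTS.
    + exists M; split; first exact: num_real.
      move=> N MN s /=; rewrite in_itv/= => /andP[s0 sz] /=.
      by apply: (le_trans (GM _ _)); rewrite ?(ltW MN)// s0 (le_trans (ltW sz)).
  - apply/disj_setPS => s [/=]; rewrite 2!in_itv/= => /andP[_ sy] /andP[].
    by rewrite leNgt sy.
have := @integral_est mu `[y, z[%classic G c e.
rewrite muE// => /=; apply => //; first by rewrite ltry.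
Qed.

End primitives.

(** * Restriction to the torus *)

Section mrestr.
Context {R : realType} (mu : {measure set R -> \bar R}) (D : set R).
Hypothesis mD : measurable D.

Lemma ae_mrestr (P : R -> Prop) : (forall x, D x -> P x) ->
  {ae mrestr mu mD, forall x, P x}.
Proof.
move=> DP; exists (~` D); split => /=.
- exact: measurableC.
- by rewrite /mrestr setICl measure0.
- by move=> x; apply: contra_not => Dx; exact: DP.
Qed.

Lemma integral_mrestr A (f : R -> \bar R) : measurable A -> measurable_fun setT f ->
  (\int[mrestr mu mD]_(x in A) f x = \int[mu]_(x in A `&` D) f x)%E.
Proof.
move=> mA mf; transitivity (\int[mrestr mu mD]_(x in A `&` D) f x)%E; last first.
  apply: eq_measure_integral => B mB BAD; rewrite /= /mrestr setIidl//.
  by move=> x /BAD[].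
rewrite integral_mkcondr; apply: ae_eq_integral => //.
- exact: measurable_funTS.
- apply/measurable_funTS/(measurable_restrictT _ _).1 => //.
  exact: measurable_funTS.
- by apply: ae_mrestr => x Dx _; rewrite patchE mem_set.
Qed.

Lemma Rintegral_mrestr A (f : R -> R) : measurable A -> measurable_fun setT f ->
  \int[mrestr mu mD]_(x in A) f x = \int[mu]_(x in A `&` D) f x.
Proof.
move=> mA mf; rewrite /Rintegral integral_mrestr//.
exact/measurable_EFinP.
Qed.

(** The two measures agree on every measurable subset of [A], so [f] may be arbitrary. *)
Lemma Rintegral_mrestr_sub A (f : R -> R) : A `<=` D ->
  \int[mrestr mu mD]_(x in A) f x = \int[mu]_(x in A) f x.
Proof.
move=> AD; rewrite /Rintegral; congr fine.
apply: eq_measure_integral => B mB BAD; rewrite /= /mrestr setIidl//.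
by move=> x /BAD /AD.
Qed.

End mrestr.

Section restriction.
Context {R : realType} (mu : {measure set R -> \bar R}).
Implicit Types (f g : R -> R) (P : R -> Prop) (A : set R).

Let D : set R := `[0, 1[%classic.

Lemma ae_restrT P : (forall x, 0 <= x < 1 -> P x) -> {ae restrT mu, forall x, P x}.
Proof.
by move=> DP; apply: ae_mrestr => x /=; rewrite in_itv/=; exact: DP.
Qed.

Lemma Rintegral_restrT A f : measurable A -> measurable_fun setT f ->
  \int[restrT mu]_(x in A) f x = \int[mu]_(x in A `&` D) f x.
Proof. exact: Rintegral_mrestr. Qed.

Lemma Rintegral_restrT_sub A f : A `<=` D ->
  \int[restrT mu]_(x in A) f x = \int[mu]_(x in A) f x.
Proof. exact: Rintegral_mrestr_sub. Qed.

Hypothesis mufin : (mu D < +oo)%E.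

Lemma restrT_fin : (restrT mu setT < +oo)%E.
Proof. by rewrite /restrT /= /mrestr setTI. Qed.

Lemma integrable_restrT_bounded f M : measurable_fun setT f ->
  (forall x, 0 <= x < 1 -> `|f x| <= M) ->
  (restrT mu).-integrable setT (EFin \o f).
Proof.
move=> mf fM; apply/integrableP; split; first exact/measurable_EFinP.
have M0 : 0 <= M by apply: le_trans (fM 0 _); rewrite ?lexx ?ltr01.
apply: le_lt_trans.
  apply: (integral_le_bound M%:E) => //.
  - exact/measurable_EFinP.
  - by apply: ae_restrT => x /fM fxM _; rewrite /= lee_fin.
by rewrite lte_mul_pinfty// ?lee_fin// restrT_fin.
Qed.

Lemma L2T_measurable f : L2T mu f -> measurable_fun setT f.
Proof. by rewrite /L2T /= inE => /andP[]; rewrite inE. Qed.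

Lemma L2TP f : measurable_fun setT f ->
  (restrT mu).-integrable setT (EFin \o (fun x => f x ^+ 2)) -> L2T mu f.
Proof.
move=> mf /integrableP[_ foo]; rewrite /L2T /= inE; apply/andP; split.
  by rewrite inE.
rewrite inE /= /finite_norm unlock poweR_lty//.
apply: le_lt_trans foo; rewrite le_eqVlt; apply/orP; left; apply/eqP.
apply: eq_integral => x _ /=.
by rewrite powR_mulrn// normrX.
Qed.

Lemma L2T_bounded f M : measurable_fun setT f ->
  (forall x, 0 <= x < 1 -> `|f x| <= M) -> L2T mu f.
Proof.
move=> mf fM; apply: L2TP => //.
apply: (@integrable_restrT_bounded _ (M ^+ 2)); first exact: measurable_funX.
by move=> x /fM h; rewrite normrX lerXn2r// nnegrE// (le_trans _ h).
Qed.

Lemma L2T_integrable f : L2T mu f -> (restrT mu).-integrable setT (EFin \o f).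
Proof.
move=> Lf; apply/Lfun1_integrable; apply: Lfun_subset12 => //.
by rewrite ge0_fin_numE// restrT_fin.
Qed.

Lemma L2T_mul_integrable f g : L2T mu f -> L2T mu g ->
  (restrT mu).-integrable setT (EFin \o (fun x => f x * g x)).
Proof. by move=> Lf Lg; apply/Lfun1_integrable; exact: Lfun2_mul_Lfun1. Qed.

End restriction.

(** * Periodic functions: reduction to one period *)

Section periodic.
Context {R : realType}.
Implicit Types (f g W : R -> R) (x l : R).

Lemma periodic_ind01 (P : R -> Prop) : (forall x, P x <-> P (x + 1)) ->
  (forall x, 0 <= x < 1 -> P x) -> forall x, P x.
Proof.
move=> PS P01 x.
have PN (n : nat) y : P y <-> P (y + n%:R).
  elim: n y => [|n IH] y; first by rewrite addr0.
  by rewrite -natr1 addrA -PS; exact: IH.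
have PZ (n : int) y : P y -> P (y + n%:~R).
  case: n => n Py; first exact: (PN n y).1.
  rewrite NegzE mulrNz; apply/(PN n.+1).
  by rewrite -[n.+1%:R]/(n.+1%:~R) subrK.
rewrite -(subrK (Num.floor x)%:~R x); apply/PZ/P01.
by have /andP[h1 h2] := floor_itv x; rewrite intrD in h2; lra.
Qed.

(** The period [(0, 1]] suits left limits: a small left neighbourhood of any of its points, 1
    included, stays in [[0, 1]]. *)
Lemma periodic_ind01' (P : R -> Prop) : (forall x, P x <-> P (x + 1)) ->
  (forall x, 0 < x <= 1 -> P x) -> forall x, P x.
Proof.
move=> PS P01; apply: periodic_ind01 => // x /andP[].
rewrite le_eqVlt => /predU1P[<- _|x0 x1]; last by apply: P01; rewrite x0 ltW.
by apply/PS; apply: P01; rewrite add0r ltr01 lexx.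
Qed.

Lemma periodic_cvg_right f x l : (forall y, f (y + 1) = f y) ->
  (f @ (x + 1)^'+ --> l) <-> (f @ x^'+ --> l).
Proof.
move=> fp; pose g h := f (x + h).
have E1 : (g h @[h --> 0^'+] --> l) <-> (f @ x^'+ --> l) by exact: cvg_at_right0D.
have E2 : (g h @[h --> 0^'+] --> l) <-> (f @ (x + 1)^'+ --> l).
  by apply: cvg_at_right0D => h; rewrite /g addrAC fp.
exact: iff_trans (iff_sym E2) E1.
Qed.

Lemma periodic_cvg_left f x l : (forall y, f (y + 1) = f y) ->
  (f @ (x + 1)^'- --> l) <-> (f @ x^'- --> l).
Proof.
move=> fp; pose g h := f (x + h).
have E1 : (g h @[h --> 0^'-] --> l) <-> (f @ x^'- --> l) by exact: cvg_at_left0D.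
have E2 : (g h @[h --> 0^'-] --> l) <-> (f @ (x + 1)^'- --> l).
  by apply: cvg_at_left0D => h; rewrite /g addrAC fp.
exact: iff_trans (iff_sym E2) E1.
Qed.

Lemma periodic_is_cvg_right f x : (forall y, f (y + 1) = f y) ->
  cvg (f @ (x + 1)^'+) <-> cvg (f @ x^'+).
Proof.
move=> fp; split=> /cvg_ex[l fl]; apply/cvg_ex; exists l.
  exact: (periodic_cvg_right x l fp).1.
exact: (periodic_cvg_right x l fp).2.
Qed.

Lemma periodic_is_cvg_left f x : (forall y, f (y + 1) = f y) ->
  cvg (f @ (x + 1)^'-) <-> cvg (f @ x^'-).
Proof.
move=> fp; split=> /cvg_ex[l fl]; apply/cvg_ex; exists l.
  exact: (periodic_cvg_left x l fp).1.
exact: (periodic_cvg_left x l fp).2.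
Qed.

Lemma periodic_cadlag f : (forall y, f (y + 1) = f y) ->
  (forall x, 0 <= x < 1 -> f @ x^'+ --> f x) ->
  (forall x, 0 < x <= 1 -> cvg (f @ x^'-)) -> cadlag f.
Proof.
move=> fp fr fl x; split.
- pose P y := f @ y^'+ --> f y.
  have PS y : P y <-> P (y + 1).
    by rewrite /P fp; exact: iff_sym (periodic_cvg_right y (f y) fp).
  exact (periodic_ind01 PS fr x).
- pose P y := cvg (f @ y^'-).
  have PS y : P y <-> P (y + 1) := iff_sym (periodic_is_cvg_left y fp).
  exact (periodic_ind01' PS fl x).
Qed.

Lemma periodic_caglad f : (forall y, f (y + 1) = f y) ->
  (forall x, 0 < x <= 1 -> f @ x^'- --> f x) ->
  (forall x, 0 <= x < 1 -> cvg (f @ x^'+)) -> caglad f.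
Proof.
move=> fp fl fr x; split.
- pose P y := f @ y^'- --> f y.
  have PS y : P y <-> P (y + 1).
    by rewrite /P fp; exact: iff_sym (periodic_cvg_left y (f y) fp).
  exact (periodic_ind01' PS fl x).
- pose P y := cvg (f @ y^'+).
  have PS y : P y <-> P (y + 1) := iff_sym (periodic_is_cvg_right y fp).
  exact (periodic_ind01 PS fr x).
Qed.

Definition periodize f x := f (x - (Num.floor x)%:~R).

Lemma periodizeD1 f x : periodize f (x + 1) = periodize f x.
Proof.
by rewrite /periodize floorDrz ?rpred1// floor1 intrD; congr f; ring.
Qed.

(** [periodize] reads only values on [[0, 1)]; the condition [f 0 = f 1] adds the endpoint 1, where
    left limits are taken. *)
Lemma periodize01 f x : f 0 = f 1 -> 0 <= x <= 1 -> periodize f x = f x.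
Proof.
move=> f01 /andP[x0]; rewrite le_eqVlt => /predU1P[->|x1].
  by rewrite -{1}[1]add0r periodizeD1 /periodize floor0 subr0.
rewrite /periodize (_ : Num.floor x = 0) ?subr0//.
by apply/eqP; rewrite floor_eq x0 add0r.
Qed.

Lemma dquotD1 W f x h : periodic_increments W -> (forall y, f (y + 1) = f y) ->
  dquot W f (x + 1) h = dquot W f x h.
Proof.
move=> Wp fp; rewrite /dquot -addrA [1 + h]addrC addrA !fp.
by congr (_ / _); have := Wp (x + h); have := Wp x; lra.
Qed.

End periodic.

(** * Regular functions and the Laplacian *)

Section regularity.
Context {R : realType} (W V : R -> R).
Hypotheses (W_incr : {homo W : x y / x < y}) (V_incr : {homo V : x y / x < y}).
Hypotheses (W_cadlag : cadlag W) (V_caglad : caglad V).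
Hypotheses (W_per : periodic_increments W) (V_per : periodic_increments V).
Hypotheses (W0 : W 0 = 0).
Context (dW dV : {measure set R -> \bar R}).
Hypothesis dWE : forall a b : R, a <= b -> dW `]a, b]%classic = (W b - W a)%:E.
Hypothesis dVE : forall a b : R, a <= b -> dV `[a, b[%classic = (V b - V a)%:E.
Implicit Types (f g : R -> R) (x y : R).

Lemma dV_fin : (dV `[0%R, 1%R[%classic < +oo)%E.
Proof. by rewrite dVE// ltry. Qed.

Lemma frakD_dminus f : frakD W V f ->
  [/\ forall x, dquot W f x h @[h --> 0^'-] --> dminus W f x,
      forall x, dminus W f (x + 1) = dminus W f x,
      caglad (dminus W f),
      forall x, dquot V (dminus W f) x h @[h --> 0^'+] --> dplus V (dminus W f) x &
      cadlag (dplus V (dminus W f))].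
Proof.
move=> [fp _ [cW Fc] [cV Gc]]; split; [exact: cW| |exact: Fc|exact: cV|exact: Gc].
move=> x; rewrite /dminus.
suff -> : dquot W f (x + 1) = dquot W f x by [].
by apply/funext => h; exact: dquotD1.
Qed.

Lemma caglad_measurable f : caglad f -> measurable_fun setT f.
Proof. by move=> fc; apply: measurable_left_cts => x; have [] := fc x. Qed.

Lemma cadlag_measurable f : cadlag f -> measurable_fun setT f.
Proof. by move=> fc; apply: measurable_right_cts => x; have [] := fc x. Qed.

Lemma dW_integrable_bounded f M z : measurable_fun setT f ->
  (forall x, 0 <= x <= 1 -> `|f x| <= M) -> 0 <= z <= 1 ->
  dW.-integrable `]0, z]%classic (EFin \o f).
Proof.
move=> mf fM /andP[z0 z1]; apply: measurable_bounded_integrable => //.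
- by rewrite dWE// ltry.
- exact: measurable_funTS.
- exists M; split; first exact: num_real.
  move=> N MN s /=; rewrite in_itv/= => /andP[s0 sz] /=.
  by rewrite (le_trans (fM _ _))// ?(ltW MN)// (ltW s0) (le_trans sz).
Qed.

(** The constants are [a = f 0] and [b = D_W^- f(0)]. Periodicity of D_W^- f is the mean-zero
    condition on the second derivative, and periodicity of [f] is the closing condition at 1. *)
Lemma frakD_laplacian f : frakD W V f -> laplacian W dW dV f (dplus V (dminus W f)).
Proof.
move=> Df; have [fF Fp Fc FG Gc] := frakD_dminus Df.
have [fp fc _ _] := Df.
set F := dminus W f in fF Fp Fc FG Gc *; set g := dplus V F in FG Gc *.
have [MF FM] := caglad_bounded 0 1 Fc.
have [MG GM] := cadlag_bounded 0 1 Gc.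
have [Mf fM] := cadlag_bounded 0 1 fc.
have mF := caglad_measurable Fc; have mg := cadlag_measurable Gc.
have mf := cadlag_measurable fc.
have KP := right_primitive_integral dVE mg GM.
have IP := left_primitive_integral dWE mF FM.
have FE y : 0 <= y <= 1 -> F y = F 0 + \int[dV]_(s in `[0, y[) g s.
  move=> y01; apply/eqP; rewrite addrC -subr_eq; apply/eqP.
  rewrite (@right_FTC _ V F g _ MG V_incr _ _ _ _ _ KP)//.
  - by rewrite set_itvco0 Rintegral_set0 subr0.
  - by move=> x _; have [] := V_caglad x.
  - by move=> x _; have [] := Fc x.
  - by move=> x _; have [] := Gc x.
have fE x : 0 <= x <= 1 -> f x = f 0 + \int[dW]_(s in `]0, x]) F s.
  move=> x01; apply/eqP; rewrite addrC -subr_eq; apply/eqP.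
  rewrite (@left_FTC _ W f F _ MF W_incr _ _ _ _ _ IP)//.
  - by rewrite set_itvoc0 Rintegral_set0 subr0.
  - by move=> y _; have [] := W_cadlag y.
  - by move=> y _; have [] := fc y.
  - by move=> y _; have [] := Fc y.
have itE x : 0 <= x <= 1 -> iterint dW dV g x = \int[dW]_(s in `]0, x]) F s - F 0 * W x.
  move=> x01; have /andP[x0 x1] := x01.
  have -> : F 0 * W x = \int[dW]_(s in `]0, x]) (cst (F 0) s).
    by rewrite Rintegral_cst// dWE//= W0 subr0.
  rewrite -RintegralB//.
  - apply: eq_Rintegral => y; rewrite inE /= in_itv/= => /andP[y0 yx].
    by rewrite FE ?(ltW y0) ?(le_trans yx)//= addrC addKr.
  - exact: (dW_integrable_bounded mF FM).
  - by apply: (@dW_integrable_bounded _ `|F 0|).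
split.
- apply: (L2T_bounded dV_fin mf (M := Mf)) => x /andP[x0 x1].
  by rewrite fM// x0 ltW.
- apply: (L2T_bounded dV_fin mg (M := MG)) => x /andP[x0 x1].
  by rewrite GM// x0 ltW.
- rewrite Rintegral_restrT// setTI.
  have := FE 1; rewrite ler01 lexx => /(_ isT).
  (* [FE] at 1 together with [F 1 = F 0]. *)
  by rewrite -{1}[1]add0r Fp -{1}[F 0]addr0 => /addrI.
- exists (f 0), (F 0); split.
    rewrite itE ?ler01 ?lexx// subrKC.
    have := fE 1; rewrite ler01 lexx => /(_ isT).
    by rewrite -{1}[1]add0r fp -{1}[f 0]addr0 => /addrI.
  apply: ae_restrT => x /andP[x0 x1].
  by rewrite itE ?x0 ?ltW// fE ?x0 ?ltW// -addrA subrKC.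
Qed.

(** The inner integral of [iterint], taken against the torus measure: an L^2 representative is
    arbitrary outside [[0, 1)], and this version is measurable and bounded on the whole line while
    agreeing with the [dV] integral for [x <= 1]. *)
Definition parint f x := \int[restrT dV]_(s in `[0, x[) f s.

Lemma parint01 f x : x <= 1 -> parint f x = \int[dV]_(s in `[0, x[) f s.
Proof.
move=> x1; apply: Rintegral_restrT_sub => s /=.
by rewrite !in_itv/= => /andP[-> /lt_le_trans]; exact.
Qed.

Lemma parint_ae_eq f g x : measurable_fun setT f -> measurable_fun setT g ->
  {ae restrT dV, forall s, f s = g s} -> parint f x = parint g x.
Proof.
move=> mf mg fg; rewrite /parint /Rintegral; congr fine.
apply: ae_eq_integral => //.
- exact/measurable_funTS/measurable_EFinP.
- exact/measurable_funTS/measurable_EFinP.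
- by apply: filterS fg => s /= -> _.
Qed.

(** Partial integrals of a nonnegative function are nondecreasing, hence measurable; [f] is the
    difference of the nonnegative functions f + |f| and |f|. The L^1 norm is the bound. *)
Lemma parint_measurable_bounded f : L2T dV f ->
  measurable_fun setT (parint f) /\ exists M, forall x, `|parint f x| <= M.
Proof.
move=> Lf; have fi := L2T_integrable dV_fin Lf.
have fiS x : (restrT dV).-integrable `[0, x[%classic (EFin \o f).
  by apply: integrableS fi.
have afi : (restrT dV).-integrable setT (EFin \o (fun s => `|f s|)).
  exact: (integrable_norm fi).
have afiS x : (restrT dV).-integrable `[0, x[%classic (EFin \o (fun s => `|f s|)).
  by apply: integrableS afi.
have mono (h : R -> R) : (restrT dV).-integrable setT (EFin \o h) ->
    (forall s, 0 <= h s) ->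
    nondecreasing_fun (parint h) /\
    forall x, parint h x <= \int[restrT dV]_s h s.
  move=> hi h0; have hiS (A : set R) : measurable A ->
    (restrT dV).-integrable A (EFin \o h) by move=> mA; exact: integrableS hi.
  have sub (A B : set R) : measurable A -> measurable B -> A `<=` B ->
      \int[restrT dV]_(s in A) h s <= \int[restrT dV]_(s in B) h s.
    move=> mA mB AB; rewrite /Rintegral fine_le//.
    - by apply: integrable_fin_num => //; exact: hiS.
    - by apply: integrable_fin_num => //; exact: hiS.
    - apply: ge0_subset_integral => //.
      + by case/integrableP : (hiS _ mB).
      + by move=> x _ /=; rewrite lee_fin.
  split=> [x y xy|x]; apply: sub => //.
  by move=> s /=; rewrite !in_itv/= => /andP[-> /lt_le_trans]; exact.
have [a1 a2] := mono _ afi (fun s => normr_ge0 _).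
have fafi : (restrT dV).-integrable setT (EFin \o (fun s => f s + `|f s|)).
  exact: (integrableD measurableT fi afi).
have f0 s : 0 <= f s + `|f s|.
  by have := ler_norm (- f s); rewrite normrN; lra.
have [b1 b2] := mono _ fafi f0.
split.
  have -> : parint f = parint (fun s => f s + `|f s|) \- parint (fun s => `|f s|).
    by apply/funext => x /=; rewrite /parint RintegralD// addrK.
  by apply: measurable_funB; exact: nondecreasing_measurable.
exists (\int[restrT dV]_s `|f s|) => x.
by apply: le_trans (a2 x); apply: le_normr_Rintegral.
Qed.


(** Since [W 0 = 0], the linear term is the [dW] integral of the constant [b]. This exhibits
    [b + parint g] as the candidate for D_W^- of the represented function. *)
Lemma iterint_parint g b x : L2T dV g -> 0 <= x <= 1 ->
  b * W x + iterint dW dV g x = \int[dW]_(y in `]0, x]) (b + parint g y).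
Proof.
move=> Lg x01; have /andP[x0 x1] := x01.
have [mK [M KM]] := parint_measurable_bounded Lg.
have -> : b * W x = \int[dW]_(s in `]0, x]) (cst b s).
  by rewrite Rintegral_cst// dWE//= W0 subr0.
rewrite (@RintegralD _ _ _ dW `]0, x]%classic (cst b) (parint g))//.
- congr (_ + _); apply: eq_Rintegral => y; rewrite inE /= in_itv/= => /andP[y0 yx].
  by rewrite parint01// (le_trans yx).
- by apply: (@dW_integrable_bounded _ `|b|).
- by apply: (@dW_integrable_bounded _ M).
Qed.

Lemma ae_restrT_impl (P Q : R -> Prop) : {ae restrT dV, forall x, P x} ->
  (forall x, 0 <= x < 1 -> P x -> Q x) -> {ae restrT dV, forall x, Q x}.
Proof.
move=> aP PQ; have := @ae_restrT _ dV _ PQ.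
by apply: filterS2 aP => x Px; exact.
Qed.

(* The double integral that represents f is cadlag, so replacing f by it inside
   that same double integral yields a function that can be differentiated twice
   everywhere. *)
Lemma laplacian_eigen_frakD f c : laplacian W dW dV f (fun x => c * f x) ->
  exists f', [/\ frakD W V f', {ae restrT dV, forall x, f x = f' x} &
    forall x, dplus V (dminus W f') x = c * f' x].
Proof.
move=> [Lf Lcf cf0 [a [b [bc fE]]]].
have mcf := L2T_measurable Lcf; have mf := L2T_measurable Lf.
set K1 := parint (fun x => c * f x).
have [mK1 [M1 K1M]] := parint_measurable_bounded Lcf.
pose G1 y := b + K1 y.
have mG1 : measurable_fun setT G1 by exact: measurable_funD.
have G1M x : 0 <= x <= 1 -> `|G1 x| <= `|b| + M1.
  by move=> _; rewrite (le_trans (ler_normD _ _))// lerD2l; exact: K1M.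
pose I1 x := \int[dW]_(s in `]0, x]) G1 s.
have I10 : I1 0 = 0 by rewrite /I1 set_itvoc0 Rintegral_set0.
have IP : left_primitive W G1 I1 := left_primitive_integral dWE mG1 G1M.
have itE x : 0 <= x <= 1 -> b * W x + iterint dW dV (fun x => c * f x) x = I1 x.
  exact: iterint_parint.
(* The closing condition of the Laplacian: [a + I1] takes the same value at 0 and 1, so its
   periodization leaves it unchanged on [[0, 1]]. *)
have I11 : I1 1 = 0 by rewrite -itE ?ler01 ?lexx.
pose f' := periodize (fun x => a + I1 x).
have f'p x : f' (x + 1) = f' x by exact: periodizeD1.
have f'E x : 0 <= x <= 1 -> f' x = a + I1 x.
  by move=> x01; rewrite /f' periodize01// I10 I11.
have f'lip y z : 0 <= y -> y <= z -> z <= 1 ->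
    `|f' z - f' y| <= (`|b| + M1) * (W z - W y).
  move=> y0 yz z1; rewrite !f'E ?y0 ?z1 ?(le_trans yz) ?(le_trans y0)//.
  have -> : a + I1 z - (a + I1 y) = I1 z - I1 y by ring.
  exact: (left_primitive_lip IP G1M).
have f'c : cadlag f'.
  apply: periodic_cadlag => // x x01.
    by apply: (lip_right_cvg f'lip) => //; have [] := W_cadlag x.
  by apply: (lip_left_is_cvg f'lip) => //; have [] := W_cadlag x.
have mf' := cadlag_measurable f'c.
have ff' : {ae restrT dV, forall x, f x = f' x}.
  apply: (ae_restrT_impl fE) => x /andP[x0 x1] ->.
  by rewrite f'E ?x0 ?ltW// -addrA itE ?x0 ?ltW.
have [Mf f'M] := cadlag_bounded 0 1 f'c.
have mcf' : measurable_fun setT (fun x => c * f' x) by exact: measurable_funM.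
have cf'M x : 0 <= x <= 1 -> `|c * f' x| <= `|c| * Mf.
  by move=> /f'M f'x; rewrite normrM ler_wpM2l.
have KP := right_primitive_integral dVE mcf' cf'M.
pose K2 x := \int[dV]_(s in `[0, x[) (c * f' s).
have K20 : K2 0 = 0 by rewrite /K2 set_itvco0 Rintegral_set0.
(* The decisive exchange: [f] and [f'] differ on a null set only, so the inner integral may be taken
   of [f'], whose right continuity makes it differentiable at every point. *)
have K12 x : x <= 1 -> K1 x = K2 x.
  move=> x1; rewrite /K2 -parint01//; apply: parint_ae_eq => //.
  by apply: filterS ff' => s ->.
(* The mean-zero condition, which lets the first derivative close up periodically. *)
have K21 : K2 1 = 0.
  rewrite -K12// /K1 parint01// -[RHS]cf0 Rintegral_restrT// setTI.
  by [].
pose G2 := periodize (fun x => b + K2 x).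
have G2p x : G2 (x + 1) = G2 x by exact: periodizeD1.
have G2E x : 0 <= x <= 1 -> G2 x = b + K2 x.
  by move=> x01; rewrite /G2 periodize01// K20 K21.
have G2P : right_primitive V (fun x => c * f' x) G2.
  move=> y z y0 yz z1 d e h; rewrite !G2E ?y0 ?z1 ?(le_trans yz) ?(le_trans y0)//.
  have -> : b + K2 z - (b + K2 y) = K2 z - K2 y by ring.
  exact: KP.
have G2lip := right_primitive_lip G2P cf'M.
have G2c : caglad G2.
  apply: periodic_caglad => // x x01.
    by apply: (lip_left_cvg G2lip) => //; have [] := V_caglad x.
  by apply: (lip_right_is_cvg G2lip) => //; have [] := V_caglad x.
(* [f'] was built from [G1], but [G1 = G2] on [(0, 1]] by [K12]. *)
have f'P : left_primitive W G2 f'.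
  move=> y z y0 yz z1 d e h; rewrite !f'E ?y0 ?z1 ?(le_trans yz) ?(le_trans y0)//.
  have -> : a + I1 z - (a + I1 y) = I1 z - I1 y by ring.
  apply: IP => // s yzs.
  have /andP[ys sz] := yzs.
  have s01 : 0 <= s <= 1 by rewrite (le_trans y0 (ltW ys)) (le_trans sz).
  by rewrite /G1 K12 -?G2E ?h//; case/andP: s01.
have dWf' x : dquot W f' x h @[h --> 0^'-] --> G2 x.
  pose P x := dquot W f' x h @[h --> 0^'-] --> G2 x.
  have PS y : P y <-> P (y + 1).
    rewrite /P G2p; suff -> : dquot W f' (y + 1) = dquot W f' y by [].
    by apply/funext => h; exact: dquotD1.
  apply: (periodic_ind01' PS) => {}x x01; apply/(dquot_leftP _ _ _ W_incr).
  by apply: left_primitive_derive f'P x01 _; have [] := G2c x.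
have dmf' : dminus W f' = G2.
  by apply/funext => x; apply: cvg_lim (dWf' x).
have dVG x : dquot V G2 x h @[h --> 0^'+] --> c * f' x.
  pose P x := dquot V G2 x h @[h --> 0^'+] --> c * f' x.
  have PS y : P y <-> P (y + 1).
    rewrite /P f'p; suff -> : dquot V G2 (y + 1) = dquot V G2 y by [].
    by apply/funext => h; exact: dquotD1.
  apply: (periodic_ind01 PS) => {}x x01; apply/(dquot_rightP _ _ _ V_incr).
  apply: (right_primitive_derive G2P x01).
  by apply: cvgMr; have [] := f'c x.
have dpf' : dplus V G2 = (fun x => c * f' x).
  by apply/funext => x; apply: cvg_lim (dVG x).
exists f'; split => //; last by move=> x; rewrite dmf' dpf'.
split => //.
- by split=> [x|]; [apply/cvg_ex; exists (G2 x)|rewrite dmf'].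
- rewrite dmf'; split=> [x|]; first by apply/cvg_ex; exists (c * f' x).
  rewrite dpf' => x; have [fr fl] := f'c x; split; first exact: cvgMr.
  exact: is_cvgMr.
Qed.

End regularity.

(** * Symmetry of the Laplacian *)

Section fubini_triangle.
Context {R : realType} (eta mu : {finite_measure set R -> \bar R}).

(** Fubini for G(y) h(x) on the triangle 0 < y <= x, whose horizontal sections are the rays [[y,
    +oo[]. It plays the role of integration by parts when both measures may have atoms. *)
Lemma fubini_triangle (G h : R -> R) (M : R) :
  measurable_fun setT G -> (forall y, `|G y| <= M) ->
  eta.-integrable setT (EFin \o h) ->
  eta.-integrable setT (EFin \o (fun x => (\int[mu]_(y in `]0, x]) G y) * h x)) /\
  \int[eta]_x ((\int[mu]_(y in `]0, x]) G y) * h x) =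
  \int[mu]_(y in `]0, +oo[) (G y * \int[eta]_(x in `[y, +oo[) h x).
Proof.
move=> mG GM hi.
have mh : measurable_fun setT h by apply/measurable_EFinP; case/integrableP : hi.
have M0 : 0 <= M by exact: le_trans (GM 0).
pose T := [set p : R * R | 0 < p.2 /\ p.2 <= p.1].
have mT : measurable T.
  rewrite (_ : T = ((fun p : R * R => 0 < p.2) @^-1` [set true]) `&`
     ((fun p : R * R => p.2 <= p.1) @^-1` [set true])) //.
  apply: measurableI; rewrite -[X in measurable X]setTI.
    exact: measurable_fun_ltr.
  exact: measurable_fun_ler.
pose phi (p : R * R) : \bar R := (\1_T p * (G p.2 * h p.1))%:E.
have mphi : measurable_fun setT phi.
  apply/measurable_EFinP; apply: measurable_funM; first exact: measurable_indic.
  apply: measurable_funM; apply: measurableT_comp => //.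
have phiM p : (`|phi p| <= (M * `|h p.1|)%:E)%E.
  rewrite /phi /= lee_fin !normrM.
  have h1 : `|\1_T p : R| <= 1.
    by rewrite indicE; case: (_ \in _); rewrite ?normr1 ?normr0.
  rewrite -[leRHS]mul1r; apply: ler_pM => //.
  exact: ler_wpM2r.
(* The integrand is dominated by M |h(x)|; its inner [eta] integral is at most the constant [C], and
   [mu] is finite. *)
have iphi : (eta \x mu)%E.-integrable setT phi.
  apply/integrable21ltyP => //.
  set C := (\int[eta]_x (M * `|h x|)%:E)%E.
  have hC : eta.-integrable setT (fun x => (M * `|h x|)%:E).
    exact: (integrableZl measurableT M (integrable_norm hi)).
  have C0 : (0 <= C)%E by apply: integral_ge0 => x _; rewrite lee_fin mulr_ge0.
  have Cfin : C \is a fin_num by exact: integrable_fin_num hC.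
  have le1 y : (\int[eta]_x `|phi (x, y)| <= C)%E.
    apply: ge0_le_integral => //.
    - apply: measurableT_comp => //.
      by apply: (measurableT_comp mphi); exact: measurable_pair2.
    - by case/integrableP : hC.
  have m2 : measurable_fun setT (fun y => \int[eta]_x `|phi (x, y)|)%E.
    apply: (measurable_fun_fubini_tonelli_G (abse \o phi)) => //.
      exact: measurableT_comp.
    by move=> p; exact: abse_ge0.
  have -> : (\int[mu]_y \int[eta]_x `|phi (x, y)|)%E =
      (\int[mu]_y `|\int[eta]_x `|phi (x, y)| |)%E.
    by apply: eq_integral => y _; rewrite gee0_abs// integral_ge0.
  apply: le_lt_trans (integral_le_bound C _ m2 C0 _) _ => //.
    by apply: aeW => y _; rewrite gee0_abs ?integral_ge0//; exact: le1.
  by rewrite lte_mul_pinfty// ltey_eq fin_num_measure.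
have iG (A : set R) : measurable A -> mu.-integrable A (EFin \o G).
  move=> mA; apply: measurable_bounded_integrable => //.
  - by rewrite ltey_eq fin_num_measure.
  - exact: measurable_funTS.
  - exists M; split; first exact: num_real.
    by move=> N MN y _ /=; rewrite (le_trans (GM _))// ltW.
have EFinR (m : {finite_measure set R -> \bar R}) (A : set R) (k : R -> R) :
    measurable A -> m.-integrable A (EFin \o k) ->
    m.-integrable setT (EFin \o (k \_ A)) /\
    (\int[m]_y ((k \_ A) y)%:E)%E = (\int[m]_(y in A) k y)%:E.
  move=> mA ik; have ikA : m.-integrable setT (EFin \o (k \_ A)).
    by rewrite -restrict_EFin; apply: (integrable_mkcond _ mA).1.
  by split => //; rewrite Rintegral_mkcond fineK//; exact: integrable_fin_num ikA.
have FE x : fubini_F mu phi x = ((\int[mu]_(y in `]0, x]) G y) * h x)%:E.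
  have [iGx GxE] := EFinR mu _ _ (measurable_itv _) (iG _ (measurable_itv `]0, x])).
  rewrite /fubini_F EFinM -GxE -integralZr//; apply: eq_integral => y _.
  rewrite /phi /= -EFinM; congr EFin; rewrite indicE patchE /T.
  have -> : ((x, y) \in [set p : R * R | 0 < p.2 /\ p.2 <= p.1]) =
      (y \in `]0, x]%classic).
    by apply/idP/idP; rewrite !inE /= in_itv/= => /andP.
  by case: ifPn => _; rewrite ?mul1r ?mul0r.
have GE y : fubini_G eta phi y =
    (((fun y => G y * \int[eta]_(x in `[y, +oo[) h x) \_ `]0, +oo[) y)%:E.
  have hiy : eta.-integrable `[y, +oo[%classic (EFin \o h) by exact: integrableS hi.
  have [ihy hyE] := EFinR eta _ _ (measurable_itv _) hiy.
  rewrite patchE; case: ifPn => [|]; last first.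
    rewrite notin_setE /= in_itv/= andbT => /negP y0.
    rewrite /fubini_G; apply: integral0_eq => x _; rewrite /phi indicE.
    by rewrite memNset ?mul0r//= => -[yp _]; rewrite yp in y0.
  rewrite inE /= in_itv/= andbT => y0.
  rewrite EFinM -hyE -integralZl//; apply: eq_integral => x _.
  rewrite /phi /= -EFinM; congr EFin; rewrite indicE patchE /T.
  have -> : ((x, y) \in [set p : R * R | 0 < p.2 /\ p.2 <= p.1]) =
      (x \in `[y, +oo[%classic).
    apply/idP/idP; rewrite !inE /= in_itv/= andbT; first by case.
    by split.
  by case: ifPn => _; rewrite ?mul1r ?mul0r// mulr0.
split.
  have := integrable_fubini_F iphi.
  rewrite (_ : fubini_F mu phi =
    EFin \o (fun x => (\int[mu]_(y in `]0, x]) G y) * h x))//.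
  exact/funext.
rewrite [RHS]Rintegral_mkcond; apply: (congr1 fine).
transitivity (\int[eta]_x fubini_F mu phi x)%E.
  by apply: eq_integral => x _; exact/esym/FE.
transitivity (\int[mu]_y fubini_G eta phi y)%E; first exact: Fubini iphi.
by apply: eq_integral => y _; exact: GE.
Qed.

End fubini_triangle.

Section symmetry.
Context {R : realType} (W V : R -> R).
Hypotheses (W0 : W 0 = 0).
Context (dW dV : {measure set R -> \bar R}).
Hypothesis dWE : forall a b : R, a <= b -> dW `]a, b]%classic = (W b - W a)%:E.
Hypothesis dVE : forall a b : R, a <= b -> dV `[a, b[%classic = (V b - V a)%:E.
Implicit Types (f g : R -> R) (x y : R).

Let dVoo : (dV `[0%R, 1%R[%classic < +oo)%E.
Proof. exact: dV_fin dVE. Qed.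

Let dWoo : (dW `]0%R, 1%R]%classic < +oo)%E.
Proof. by rewrite dWE// ltry. Qed.

(** The restrictions are finite measures, as [fubini_triangle] requires; the closed ends differ
    because [dV] is given on [[a, b)] and [dW] on [(a, b]]. *)
Let eta := mfrestr (measurable_itv `[(0 : R), 1[) dVoo.
Let mu := mfrestr (measurable_itv `](0 : R), 1]) dWoo.

(** The total integral vanishes, so the tail beyond [y] is minus the part before [y]. *)
Lemma integral_ray_parint g y : L2T dV g -> \int[restrT dV]_x g x = 0 -> 0 < y ->
  \int[restrT dV]_(x in `[y, +oo[) g x = - parint dV g y.
Proof.
move=> Lg g0 y0; have gi := L2T_integrable dVoo Lg.
have mg := L2T_measurable Lg.
have : \int[restrT dV]_(x in `]-oo, y[ `|` `[y, +oo[) g x = 0.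
  rewrite -itv_bndbnd_setU// -?g0 ?bnd_simp//.
  by congr (Rintegral _ _ _); apply/seteqP; split => // x _ /=; rewrite in_itv.
rewrite Rintegral_setU//.
- move=> /eqP; rewrite addrC addr_eq0 => /eqP ->; congr (- _).
  rewrite /parint !Rintegral_restrT//; congr (Rintegral _ _ _).
  apply/seteqP; split => x /=; rewrite !in_itv/=.
    by move=> [xy /andP[x0 x1]]; rewrite x0 xy.
  by move=> [/andP[_ xy]].
- by apply: integrableS gi => //; exact: measurableU.
- apply/disj_setPS => s [/=]; rewrite 2!in_itv/= => sy; rewrite andbT.
  by rewrite leNgt sy.
Qed.

(* b' is arbitrary because b + parint g has zero dW-integral over (0, 1]. *)
Lemma laplacian_energy f g g' a b b' : L2T dV f -> L2T dV g -> L2T dV g' ->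
  b * W 1 + iterint dW dV g 1 = 0 -> \int[restrT dV]_x g' x = 0 ->
  {ae restrT dV, forall x, f x = a + b * W x + iterint dW dV g x} ->
  innerT dV f g' =
  - \int[dW]_(y in `]0, 1]) ((b + parint dV g y) * (b' + parint dV g' y)).
Proof.
move=> Lf Lg Lg' bg g'0 fE.
have [mK [M KM]] := parint_measurable_bounded dVE Lg.
have [mK' [M' K'M]] := parint_measurable_bounded dVE Lg'.
have g'i := L2T_integrable dVoo Lg'.
have mf := L2T_measurable Lf; have mg' := L2T_measurable Lg'.
pose G y := b + parint dV g y.
have mG : measurable_fun setT G by exact: measurable_funD.
have GM y : `|G y| <= `|b| + M.
  by rewrite (le_trans (ler_normD _ _))// lerD2l.
pose I x := \int[mu]_(y in `]0, x]) G y.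
have [Ii IE] : (eta : {measure set R -> \bar R}).-integrable setT
    (EFin \o (fun x => I x * g' x)) /\
  \int[eta]_x (I x * g' x) =
  \int[mu]_(y in `]0, +oo[) (G y * \int[eta]_(x in `[y, +oo[) g' x).
  exact (@fubini_triangle _ eta mu G g' _ mG GM g'i).
have IW x : 0 <= x <= 1 -> I x = \int[dW]_(y in `]0, x]) G y.
  move=> /andP[x0 x1]; apply: Rintegral_mrestr_sub => y /=.
  by rewrite !in_itv/= => /andP[-> /le_trans]; exact.
have fI : innerT dV f g' = \int[restrT dV]_x (a * g' x + I x * g' x).
  rewrite /innerT /Rintegral; congr fine; apply: ae_eq_integral => //.
  - by apply/measurable_EFinP; exact: measurable_funM.
  - apply/measurable_EFinP; apply: measurable_funD; first exact: measurable_funM.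
    by apply/measurable_EFinP; case/integrableP : Ii.
  - suff fE' : {ae restrT dV, forall x, f x = a + I x}.
      by apply: filterS fE' => x /= -> _; rewrite mulrDl.
    apply: (ae_restrT_impl fE) => x /andP[x0 x1] ->.
    have x01 : 0 <= x <= 1 by rewrite x0 ltW.
    by rewrite IW// -addrA (iterint_parint W0 dWE dVE).
rewrite fI RintegralD//; last first.
  exact: (integrableZl measurableT a g'i).
rewrite RintegralZl// g'0 mulr0 add0r.
have G0 : \int[dW]_(y in `]0, 1]) G y = 0.
  by rewrite -(iterint_parint W0 dWE dVE)// ler01 lexx.
have i01 (k : R -> R) N : measurable_fun setT k -> (forall y, `|k y| <= N) ->
    dW.-integrable `]0, 1]%classic (EFin \o k).
  move=> mk kN; apply: (dW_integrable_bounded dWE mk (M := N)) => //.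
  by rewrite ler01 lexx.
have iGK : dW.-integrable `]0, 1]%classic
    (EFin \o (fun y => G y * (b' + parint dV g' y))).
  apply: (i01 _ ((`|b| + M) * (`|b'| + M'))).
    by apply: measurable_funM => //; exact: measurable_funD.
  move=> y; rewrite normrM ler_pM//.
  by rewrite (le_trans (ler_normD _ _))// lerD2l.
(* Fubini produces the integrand -G parint(g'); adding and subtracting [b' G] costs nothing because
   [G] integrates to 0 by [G0]. *)
transitivity (\int[dW]_(y in `]0, 1]) (b' * G y - G y * (b' + parint dV g' y))).
  rewrite [LHS]IE.
  transitivity (\int[mu]_(y in `]0, +oo[) (b' * G y - G y * (b' + parint dV g' y))).
    apply: eq_Rintegral => y; rewrite inE /= in_itv/= andbT => y0.
    have -> : \int[eta]_(x in `[y, +oo[) g' x = - parint dV g' y.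
      exact: integral_ray_parint.
    ring.
  have mk : measurable_fun setT (fun y => b' * G y - G y * (b' + parint dV g' y)).
    apply: measurable_funB; first exact: measurable_funM.
    by apply: measurable_funM => //; exact: measurable_funD.
  transitivity (\int[dW]_(y in `]0, +oo[ `&` `]0, 1])
      (b' * G y - G y * (b' + parint dV g' y))).
    exact: Rintegral_mrestr.
  congr (Rintegral _ _ _); apply/seteqP; split => y /=; rewrite !in_itv/=; first by case.
  by move=> /andP[-> ->].
have iG := i01 _ _ mG GM.
rewrite RintegralB//; last exact: (integrableZl _ b' iG).
by rewrite RintegralZl// G0 mulr0 sub0r.
Qed.

(** Choosing the free constant of [laplacian_energy] to be the one of the other function turns both
    sides into the same symmetric [dW] integral. *)
Lemma laplacian_sym f g f' g' : laplacian W dW dV f g -> laplacian W dW dV f' g' ->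
  innerT dV f g' = innerT dV g f'.
Proof.
move=> [Lf Lg g0 [a [b [bg fE]]]] [Lf' Lg' g'0 [a' [b' [bg' fE']]]].
have -> : innerT dV g f' = innerT dV f' g.
  by apply: eq_Rintegral => x _; rewrite mulrC.
rewrite (laplacian_energy b' Lf Lg Lg' bg g'0 fE).
rewrite (laplacian_energy b Lf' Lg' Lg bg' g0 fE').
by congr (- _); apply: eq_Rintegral => x _; rewrite mulrC.
Qed.

End symmetry.

(** * Linearity of [frakD] and of the double derivative *)

Section frakD_linear.
Context {R : realType} (W V : R -> R).
Implicit Types (f g : R -> R) (a : R).

Let D f := dplus V (dminus W f).

Lemma dquot_lin (F : R -> R) a f g x h :
  dquot F (fun y => a * f y + g y) x h = a * dquot F f x h + dquot F g x h.
Proof. by rewrite /dquot mulrA -mulrDl; congr (_ / _); ring. Qed.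

Lemma cadlag_lin a f g : cadlag f -> cadlag g -> cadlag (fun y => a * f y + g y).
Proof.
move=> cf cg x; have [fr fl] := cf x; have [gr gl] := cg x; split.
  by apply: cvgD => //; exact: cvgMr.
by apply: is_cvgD => //; exact: is_cvgMr.
Qed.

Lemma caglad_lin a f g : caglad f -> caglad g -> caglad (fun y => a * f y + g y).
Proof.
move=> cf cg x; have [fr fl] := cf x; have [gr gl] := cg x; split.
  by apply: cvgD => //; exact: cvgMr.
by apply: is_cvgD => //; exact: is_cvgMr.
Qed.

Lemma dquot_lin_cvgl (F : R -> R) a f g x (l m : R) :
  dquot F f x h @[h --> 0^'-] --> l -> dquot F g x h @[h --> 0^'-] --> m ->
  dquot F (fun y => a * f y + g y) x h @[h --> 0^'-] --> a * l + m.
Proof.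
move=> fl gm; rewrite (_ : dquot _ _ _ = fun h => a * dquot F f x h + dquot F g x h).
  by apply: cvgD => //; exact: cvgMr.
by apply/funext => h; rewrite dquot_lin.
Qed.

Lemma dquot_lin_cvgr (F : R -> R) a f g x (l m : R) :
  dquot F f x h @[h --> 0^'+] --> l -> dquot F g x h @[h --> 0^'+] --> m ->
  dquot F (fun y => a * f y + g y) x h @[h --> 0^'+] --> a * l + m.
Proof.
move=> fl gm; rewrite (_ : dquot _ _ _ = fun h => a * dquot F f x h + dquot F g x h).
  by apply: cvgD => //; exact: cvgMr.
by apply/funext => h; rewrite dquot_lin.
Qed.

Lemma frakD_lin a f g : frakD W V f -> frakD W V g ->
  frakD W V (fun x => a * f x + g x) /\
  dplus V (dminus W (fun x => a * f x + g x)) =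
    (fun x => a * dplus V (dminus W f) x + dplus V (dminus W g) x).
Proof.
move=> [fp fc [dWf cWf] [dVf cVf]] [gp gc [dWg cWg] [dVg cVg]].
pose F := fun x => a * f x + g x.
have dWF x : dquot W F x h @[h --> 0^'-] --> a * dminus W f x + dminus W g x.
  by apply: dquot_lin_cvgl; [exact: dWf|exact: dWg].
have dWFE : dminus W F = fun x => a * dminus W f x + dminus W g x.
  by apply/funext => x; apply: cvg_lim (dWF x).
have dVF x : dquot V (dminus W F) x h @[h --> 0^'+] -->
    a * dplus V (dminus W f) x + dplus V (dminus W g) x.
  by rewrite dWFE; apply: dquot_lin_cvgr; [exact: dVf|exact: dVg].
have dVFE : dplus V (dminus W F) =
    fun x => a * dplus V (dminus W f) x + dplus V (dminus W g) x.
  by apply/funext => x; apply: cvg_lim (dVF x).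
split; last exact: dVFE.
split.
- by move=> x; rewrite fp gp.
- exact: cadlag_lin.
- split; last by rewrite dWFE; exact: caglad_lin.
  by move=> x; apply/cvg_ex; eexists; exact: dWF.
- split; last by rewrite dVFE; exact: cadlag_lin.
  by move=> x; apply/cvg_ex; eexists; exact: dVF.
Qed.

Lemma frakD_cst a : frakD W V (fun=> a) /\ dplus V (dminus W (fun=> a)) = fun=> 0.
Proof.
have q (F : R -> R) (c : R) x : dquot F (fun=> c) x = fun=> 0.
  by apply/funext => h; rewrite /dquot subrr mul0r.
have dW0 : dminus W (fun=> a) = fun=> 0.
  by apply/funext => x; rewrite /dminus q; exact: lim_cst.
have dV0 : dplus V (fun=> 0) = fun=> 0.
  by apply/funext => x; rewrite /dplus q; exact: lim_cst.
split; last by rewrite dW0.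
split => //.
- by move=> x; split; [exact: cvg_cst|exact: is_cvg_cst].
- rewrite dW0; split=> [x|x]; first by rewrite q; exact: is_cvg_cst.
  by split; [exact: cvg_cst|exact: is_cvg_cst].
- rewrite dW0 dV0; split=> [x|x]; first by rewrite q; exact: is_cvg_cst.
  by split; [exact: cvg_cst|exact: is_cvg_cst].
Qed.

End frakD_linear.

(** * Orthonormal expansions *)

Section hilbert.
Context {R : realType} (mu : {measure set R -> \bar R}).
Hypothesis mufin : (mu `[0%R, 1%R[%classic < +oo)%E.
Implicit Types (f g h : R -> R) (a : R).

Local Notation "<| f , g |>" := (innerT mu f g) (at level 0, f, g at level 69).

Lemma L2T_lin a f g : L2T mu f -> L2T mu g -> L2T mu (fun x => a * f x + g x).
Proof.
move=> Lf Lg; have h12 : (1 <= 2%:E :> \bar R)%E by rewrite lee_fin ler1n.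
exact: ((@Lfun_submod_closed _ _ _ (restrT mu) _ h12).2 a f g Lf Lg).
Qed.

Lemma L2T_cst a : L2T mu (fun=> a).
Proof. exact: (@L2T_bounded _ _ mufin _ `|a|). Qed.

Lemma L2T_B f g : L2T mu f -> L2T mu g -> L2T mu (f \- g).
Proof.
move=> Lf Lg; rewrite (_ : f \- g = fun x => -1 * g x + f x); first exact: L2T_lin.
by apply/funext => x /=; ring.
Qed.

Lemma L2T_bigsum (c : nat -> R) (u : nat -> R -> R) (s : seq nat) :
  (forall i, L2T mu (u i)) -> L2T mu (fun x => \sum_(i <- s) c i * u i x).
Proof.
move=> Lu; elim: s => [|i s IH].
  rewrite (_ : (fun _ => _) = fun=> 0); first exact: L2T_cst.
  by apply/funext => x; rewrite big_nil.
rewrite (_ : (fun _ => _) = fun x => c i * u i x + \sum_(j <- s) c j * u j x).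
  exact: L2T_lin.
by apply/funext => x; rewrite big_cons.
Qed.

Lemma L2T_sum (c : nat -> R) (u : nat -> R -> R) m n : (forall i, L2T mu (u i)) ->
  L2T mu (fun x => \sum_(m <= i < n) c i * u i x).
Proof. exact: L2T_bigsum. Qed.

Lemma innerTC f g : <|f, g|> = <|g, f|>.
Proof. by apply: eq_Rintegral => x _; rewrite mulrC. Qed.

Lemma innerT_linl a f g h : L2T mu f -> L2T mu g -> L2T mu h ->
  <|(fun x => a * f x + g x), h|> = a * <|f, h|> + <|g, h|>.
Proof.
move=> Lf Lg Lh; have ifh := L2T_mul_integrable Lf Lh.
rewrite /innerT -RintegralZl// -RintegralD//.
- by apply: eq_Rintegral => x _; rewrite mulrDl mulrA.
- exact: (integrableZl measurableT a ifh).
- exact: L2T_mul_integrable.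
Qed.

Lemma innerT_Zl a f h : L2T mu f -> L2T mu h ->
  <|(fun x => a * f x), h|> = a * <|f, h|>.
Proof.
move=> Lf Lh; rewrite /innerT -RintegralZl//; last exact: L2T_mul_integrable.
by apply: eq_Rintegral => x _; rewrite mulrA.
Qed.

Lemma innerT_Bl f g h : L2T mu f -> L2T mu g -> L2T mu h ->
  <|f \- g, h|> = <|f, h|> - <|g, h|>.
Proof.
move=> Lf Lg Lh; rewrite (_ : f \- g = fun x => -1 * g x + f x).
  by rewrite innerT_linl//; ring.
by apply/funext => x /=; ring.
Qed.

Lemma innerT_suml (c : nat -> R) (u : nat -> R -> R) m n h :
  (forall i, L2T mu (u i)) -> L2T mu h ->
  <|(fun x => \sum_(m <= i < n) c i * u i x), h|> = \sum_(m <= i < n) c i * <|u i, h|>.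
Proof.
move=> Lu Lh; elim: (index_iota m n) => [|i s IH].
  rewrite big_nil (_ : (fun _ => _) = fun=> 0).
    rewrite /innerT; under eq_Rintegral do rewrite mul0r.
    by rewrite Rintegral_cst// mul0r.
  by apply/funext => x; rewrite big_nil.
rewrite (_ : (fun _ => _) = fun x => c i * u i x + \sum_(j <- s) c j * u j x).
  by rewrite innerT_linl ?big_cons ?IH//; exact: L2T_bigsum.
by apply/funext => x; rewrite big_cons.
Qed.

Lemma innerT_ge0 f : 0 <= <|f, f|>.
Proof. by apply: Rintegral_ge0 => x _; rewrite -expr2 sqr_ge0. Qed.

Lemma innerT_CS f g : L2T mu f -> L2T mu g ->
  <|f, g|> ^+ 2 <= <|f, f|> * <|g, g|>.
Proof.
move=> Lf Lg; set p := <|f, g|>; set q := <|g, g|>; set r := <|f, f|>.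
have H t : 0 <= t ^+ 2 * r + 2 * t * p + q.
  have Lh := L2T_lin t Lf Lg.
  have := innerT_ge0 (fun x => t * f x + g x).
  rewrite innerT_linl// ![<|_, (fun x => t * f x + g x)|>]innerTC !innerT_linl//.
  rewrite [<|g, f|>]innerTC -/p -/q -/r.
  by move=> h; apply: le_trans h _; rewrite le_eqVlt; apply/orP; left; apply/eqP; ring.
have := innerT_ge0 f; rewrite -/r le_eqVlt => /predU1P[r0|r0].
  rewrite -r0 mul0r; have [->|p0] := eqVneq p 0; first by rewrite expr0n.
  (* With [r = 0] the quadratic is affine in [t]; this [t] gives it the value -1. *)
  have := H (- (q + 1) / (2 * p)); rewrite -r0 mulr0 add0r.
  have -> : 2 * (- (q + 1) / (2 * p)) * p = - (q + 1) by field.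
  by rewrite opprD addrAC addNr add0r lerNr oppr0 leNgt ltr01.
(* The minimizer of the quadratic. *)
have := H (- p / r).
have -> : (- p / r) ^+ 2 * r + 2 * (- p / r) * p + q = q - p ^+ 2 / r.
  by field; rewrite gt_eqF.
by rewrite subr_ge0 ler_pdivrMr// mulrC.
Qed.

Lemma LnormE f : L2T mu f ->
  ('N[restrT mu]_2%:E[EFin \o f])%E = (Num.sqrt <|f, f|>)%:E.
Proof.
move=> Lf; rewrite unlock /=.
have -> : (\int[restrT mu]_x (`|f x| `^ 2)%:E)%E = (<|f, f|>)%:E.
  rewrite /innerT /Rintegral fineK; last first.
    by apply: integrable_fin_num (L2T_mul_integrable Lf Lf).
  by apply: eq_integral => x _; rewrite powR_mulrn// real_normK ?num_real// expr2.
by rewrite poweR_EFin powR12_sqrt// innerT_ge0.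
Qed.

Lemma L2T_cvgP (f_ : nat -> R -> R) f : (forall n, L2T mu (f_ n)) -> L2T mu f ->
  L2T_cvg mu f_ f <-> <|f_ n \- f, f_ n \- f|> @[n --> \oo] --> 0.
Proof.
move=> Lf_ Lf; rewrite /L2T_cvg.
have E n : ('N[restrT mu]_2%:E[EFin \o (f_ n \- f)%R])%E =
    (Num.sqrt <|f_ n \- f, f_ n \- f|>)%:E.
  by rewrite LnormE//; exact: L2T_B.
under eq_fun do rewrite E.
split=> h.
- have h' : Num.sqrt <|f_ n \- f, f_ n \- f|> @[n --> \oo] --> 0 by exact: fine_cvg h.
  rewrite -(mulr0 0) (_ : (fun n => _) = fun n => Num.sqrt <|f_ n \- f, f_ n \- f|> *
      Num.sqrt <|f_ n \- f, f_ n \- f|>); first exact: cvgM.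
  by apply/funext => n; rewrite -expr2 sqr_sqrtr ?innerT_ge0.
- apply: cvg_EFin; first exact: nearW.
  rewrite -sqrtr0; apply: continuous_cvg => //; exact: sqrt_continuous.
Qed.

Lemma cvg_innerT (f_ : nat -> R -> R) f g : (forall n, L2T mu (f_ n)) -> L2T mu f ->
  L2T mu g -> L2T_cvg mu f_ f -> <|f_ n, g|> @[n --> \oo] --> <|f, g|>.
Proof.
move=> Lf_ Lf Lg /(L2T_cvgP Lf_ Lf) h.
apply/cvgrPdist_le => e e0.
have /cvgrPdist_le h' : <|f_ n \- f, f_ n \- f|> * <|g, g|> @[n --> \oo] --> 0.
  by rewrite -(mul0r <|g, g|>); exact: cvgMl.
have e20 : 0 < e ^+ 2 by rewrite exprn_gt0.
apply: filterS (h' _ e20) => n; rewrite sub0r normrN => hn.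
rewrite distrC -innerT_Bl// -(@ler_pXn2r _ 2)// ?nnegrE// ?(ltW e0)//.
rewrite real_normK ?num_real// (le_trans (innerT_CS _ _))//; first exact: L2T_B.
exact: le_trans (ler_norm _) _.
Qed.

Context (nu : nat -> R -> R) (nuB : orthonormal_basis mu nu).

Lemma basis_L2T i : L2T mu (nu i). Proof. by case: nuB. Qed.

Lemma innerT_sum_basis (c : nat -> R) m n j :
  <|(fun x => \sum_(m <= i < n) c i * nu i x), nu j|> =
  if (m <= j < n)%N then c j else 0.
Proof.
have [Ln nn _] := nuB.
rewrite innerT_suml//; under eq_bigr do rewrite nn.
case: ifPn => mjn.
  rewrite (bigD1_seq j) ?mem_index_iota ?iota_uniq//= eqxx mulr1 big1 ?addr0//.
  by move=> i /negbTE ->; rewrite mulr0.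
rewrite big_seq big1// => i; rewrite mem_index_iota => imn.
by case: eqP => [ij|_]; rewrite ?mulr0//; rewrite -ij imn in mjn.
Qed.

(** The inner products of the partial sums with [nu j] are equal to [c j] as soon as [n > j], and
    they converge by continuity of the inner product. *)
Lemma fourier_coef (c : nat -> R) f j : L2T mu f ->
  L2T_cvg mu (fun n x => \sum_(0 <= i < n) c i * nu i x) f -> <|f, nu j|> = c j.
Proof.
move=> Lf cf; have Lj := basis_L2T j.
have h1 := cvg_innerT (fun n => L2T_sum c 0 n basis_L2T) Lf Lj cf.
apply/esym/(@cvg_unique _ _ _ _ _ _ _ h1); first exact: norm_hausdorff.
apply: cvg_near_cst; near=> n.
rewrite innerT_sum_basis /=; case: ifPn => // /negP[].
by near: n; exact: nbhs_infty_gt.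
Unshelve. all: by end_near. Qed.

(** Only [f] is expanded, and the inner product with [g] is continuous. The version for two
    functions is needed for the pair f - D_V^+ D_W^- f and f. *)
Lemma parseval f g : L2T mu f -> L2T mu g ->
  \sum_(0 <= i < n) <|f, nu i|> * <|g, nu i|> @[n --> \oo] --> <|f, g|>.
Proof.
move=> Lf Lg; have [Ln _ nB] := nuB.
have [c cf] := nB f Lf.
have h1 := cvg_innerT (fun n => L2T_sum c 0 n basis_L2T) Lf Lg cf.
apply: cvg_trans h1; apply: near_eq_cvg; near=> n.
rewrite innerT_suml//; apply: eq_bigr => i _.
by rewrite (fourier_coef i Lf cf) innerTC.
Unshelve. all: by end_near. Qed.

End hilbert.

(** * Spectral description *)

Section ae_equal.
Context {R : realType} (mu : {measure set R -> \bar R}).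
Hypothesis mufin : (mu `[0%R, 1%R[%classic < +oo)%E.
Implicit Types (f g : R -> R).

Lemma innerT_ae f f' g g' : L2T mu f -> L2T mu f' -> L2T mu g -> L2T mu g' ->
  {ae restrT mu, forall x, f x = f' x} -> {ae restrT mu, forall x, g x = g' x} ->
  innerT mu f g = innerT mu f' g'.
Proof.
move=> Lf Lf' Lg Lg' ff' gg'; rewrite /innerT /Rintegral; congr fine.
apply: ae_eq_integral => //.
- apply/measurable_EFinP/measurable_funM.
    exact: L2T_measurable Lf.
  exact: L2T_measurable Lg.
- apply/measurable_EFinP/measurable_funM.
    exact: L2T_measurable Lf'.
  exact: L2T_measurable Lg'.
- by apply: filterS2 ff' gg' => x /= -> -> _.
Qed.

Lemma L2T_cvg_ae (f_ g_ : nat -> R -> R) f : (forall n, L2T mu (f_ n)) ->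
  (forall n, L2T mu (g_ n)) -> L2T mu f ->
  (\forall n \near \oo, {ae restrT mu, forall x, f_ n x = g_ n x}) ->
  L2T_cvg mu f_ f -> L2T_cvg mu g_ f.
Proof.
move=> Lf_ Lg_ Lf fg /(L2T_cvgP Lf_ Lf) h; apply/(L2T_cvgP Lg_ Lf).
apply: cvg_trans h; apply: near_eq_cvg.
apply: filterS fg => n fgn.
apply: innerT_ae; try exact: L2T_B; by apply: filterS fgn => x /= ->.
Qed.

Lemma L2T_affine (a : R) (c : nat -> R) (u : nat -> R -> R) m n :
  (forall i, L2T mu (u i)) -> L2T mu (fun x => a + \sum_(m <= i < n) c i * u i x).
Proof.
move=> Lu; rewrite (_ : (fun _ => _) = fun x => a * 1 + \sum_(m <= i < n) c i * u i x).
  exact: (L2T_lin a (L2T_cst mufin 1) (L2T_sum mufin c m n Lu)).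
by apply/funext => x; rewrite mulr1.
Qed.

Lemma ae_eq_sum (c : nat -> R) (u v : nat -> R -> R) m n :
  (forall i, {ae restrT mu, forall x, u i x = v i x}) ->
  {ae restrT mu, forall x,
    \sum_(m <= i < n) c i * u i x = \sum_(m <= i < n) c i * v i x}.
Proof.
move=> uv; elim: (index_iota m n) => [|i s IH].
  by apply: aeW => x; rewrite !big_nil.
by apply: filterS2 (uv i) IH => x h1 h2; rewrite !big_cons h1 h2.
Qed.

End ae_equal.

Section spectral.
Context {R : realType} (W V : R -> R).
Hypotheses (W_incr : {homo W : x y / x < y}) (V_incr : {homo V : x y / x < y}).
Hypotheses (W_cadlag : cadlag W) (V_caglad : caglad V).
Hypotheses (W_per : periodic_increments W) (V_per : periodic_increments V).
Hypotheses (W0 : W 0 = 0).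
Context (dW dV : {measure set R -> \bar R}).
Hypothesis dWE : forall a b : R, a <= b -> dW `]a, b]%classic = (W b - W a)%:E.
Hypothesis dVE : forall a b : R, a <= b -> dV `[a, b[%classic = (V b - V a)%:E.
Context (nu : nat -> R -> R) (lambda : nat -> R).
Hypothesis nuP : laplacian_eigenbasis W dW dV nu lambda.
Implicit Types (f g : R -> R) (x y : R).

Let dVoo : (dV `[0%R, 1%R[%classic < +oo)%E.
Proof. exact: dV_fin dVE. Qed.

Let nuB : orthonormal_basis dV nu. Proof. by case: nuP. Qed.

Let Lnu i : L2T dV (nu i). Proof. exact: basis_L2T nuB i. Qed.

Local Notation "<| f , g |>" := (innerT dV f g) (at level 0, f, g at level 69).
Local Notation DD f := (dplus V (dminus W f)).

Lemma lambda_ge0 i : 0 <= lambda i.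
Proof. by have [_ _ _ l0 [lm _]] := nuP; rewrite -l0; exact: lm. Qed.

Lemma frakD_L2T f : frakD W V f -> L2T dV f /\ L2T dV (DD f).
Proof.
move=> Df.
by have [? ?] := frakD_laplacian W_incr V_incr W_cadlag V_caglad W_per W0 dWE dVE Df.
Qed.

(** Symmetry against the eigenpair moves the double derivative onto [nu i], so the i-th coefficient
    of f - D_V^+ D_W^- f is (1 + lambda_i) <f, nu_i>. *)
Lemma energy_cvg f : frakD W V f ->
  \sum_(0 <= i < n) (1 + lambda i) * <|f, nu i|> ^+ 2 @[n --> \oo]
    --> <|f \- DD f, f|>.
Proof.
move=> Df; have [Lf LD] := frakD_L2T Df.
have Lap := frakD_laplacian W_incr V_incr W_cadlag V_caglad W_per W0 dWE dVE Df.
have [_ eig _ _ _] := nuP.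
have := parseval dVoo nuB (L2T_B Lf LD) Lf.
apply: cvg_trans; apply: near_eq_cvg; apply: nearW => n; apply: eq_bigr => i _.
have := laplacian_sym W0 dWE dVE Lap (eig i).
have -> : <|f, (fun x => - lambda i * nu i x)|> = - lambda i * <|f, nu i|>.
  by rewrite innerTC innerT_Zl// innerTC.
rewrite innerT_Bl// => <-; ring.
Qed.

Lemma energy_ge f n : frakD W V f ->
  \sum_(0 <= i < n) (1 + lambda i) * <|f, nu i|> ^+ 2 <= <|f \- DD f, f|>.
Proof.
move=> Df; have h := energy_cvg Df; rewrite -(cvg_lim _ h)//.
apply: nondecreasing_cvgn_le; last by apply/cvg_ex; eexists; exact: h.
apply/nondecreasing_seqP => k; rewrite big_nat_recr//= lerDl mulr_ge0 ?sqr_ge0//.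
by rewrite addr_ge0// lambda_ge0.
Qed.

Lemma lambda_energy_le f n : frakD W V f ->
  \sum_(0 <= i < n) lambda i * <|f, nu i|> ^+ 2 <= norm12 W V dV f ^+ 2.
Proof.
(* The empty partial sum in [energy_ge] says that the form is nonnegative, so the square undoes the
   root. *)
move=> Df; rewrite sqr_sqrtr; last first.
  by have := energy_ge 0 Df; rewrite big_geq.
apply: le_trans (energy_ge n Df); apply: ler_sum => i _.
by rewrite mulrDl lerDr mul1r sqr_ge0.
Qed.

Lemma frakD_B f g : frakD W V f -> frakD W V g -> frakD W V (f \- g).
Proof.
move=> Df Dg; have [h _] := frakD_lin (-1) Dg Df.
rewrite (_ : f \- g = fun x => -1 * g x + f x)//.
by apply/funext => x /=; ring.
Qed.

(** For fixed [n] the finite sum passes to the limit along [f_]. Uniformity in [n] comes from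
    comparing [f_ m] with one fixed [f_ N] at Cauchy distance below 1, whence the constant 2
    ||f_N||^2 + 2. *)
Lemma HWV_lambda_bounded f : HWV W V dV f ->
  exists C, forall n, \sum_(0 <= i < n) lambda i * <|f, nu i|> ^+ 2 <= C.
Proof.
move=> [Lf [f_ [Df_ ff cf]]].
have [N HN] := cf 1 ltr01.
have Lf_ n : L2T dV (f_ n) by have [] := frakD_L2T (Df_ n).
exists (2 * norm12 W V dV (f_ N) ^+ 2 + 2) => n.
have cs : \sum_(0 <= i < n) lambda i * <|f_ m, nu i|> ^+ 2 @[m --> \oo] -->
    \sum_(0 <= i < n) lambda i * <|f, nu i|> ^+ 2.
  elim: (index_iota 0 n) => [|i s IH].
    by rewrite big_nil; under eq_fun do rewrite big_nil; exact: cvg_cst.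
  rewrite big_cons; under eq_fun do rewrite big_cons.
  apply: cvgD IH; apply: cvgMr.
  rewrite expr2; under eq_fun do rewrite expr2.
  have h := cvg_innerT Lf_ Lf (Lnu i) ff.
  exact: (cvgM h h).
apply: (ler_cvg_to cs (@cvg_cst _ _ _ _ _)).
near=> m.
have Nm : (N <= m)%N by near: m; exact: nbhs_infty_ge.
(* Termwise a^2 <= 2 b^2 + 2 (a - b)^2, the difference being (a - 2b)^2. *)
apply: (@le_trans _ _ (2 * \sum_(0 <= i < n) lambda i * <|f_ N, nu i|> ^+ 2 +
   2 * \sum_(0 <= i < n) lambda i * <|f_ m \- f_ N, nu i|> ^+ 2)).
  rewrite -mulrDr -big_split/= mulr_sumr; apply: ler_sum => i _.
  rewrite innerT_Bl//; set a := <|f_ m, _|>; set b := <|f_ N, _|>; set l := lambda i.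
  have -> : 2 * (l * b ^+ 2 + l * (a - b) ^+ 2) = l * (2 * b ^+ 2 + 2 * (a - b) ^+ 2).
    by ring.
  rewrite ler_wpM2l ?lambda_ge0// -subr_ge0.
  have -> : 2 * b ^+ 2 + 2 * (a - b) ^+ 2 - a ^+ 2 = (a - 2 * b) ^+ 2 by ring.
  exact: sqr_ge0.
apply: lerD; first by rewrite ler_wpM2l// lambda_energy_le.
rewrite -[leRHS]mulr1 ler_wpM2l// (le_trans (lambda_energy_le _ _))//.
  exact: frakD_B.
by rewrite exprn_ile1 ?sqrtr_ge0// ltW// HN.
Unshelve. all: by end_near. Qed.

Lemma HWV_spectral f : HWV W V dV f -> exists alpha : nat -> R,
      L2T_cvg dV
        (fun n x => alpha 0%N + \sum_(1 <= i < n) alpha i * nu i x) f /\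
      (\sum_(1 <= i <oo) (lambda i * alpha i ^+ 2)%:E < +oo)%E.
Proof.
move=> Hf; have [Lf _] := Hf.
have [_ _ [c0 nu0] l0 _] := nuP; have [_ _ nB] := nuB.
have [c cf] := nB f Lf.
have cE i : <|f, nu i|> = c i by exact: fourier_coef cf.
(* The constant term absorbs the a.e. value [c0] of [nu 0]. The weighted sum is unaffected, since
   [lambda 0 = 0]. *)
pose alpha i := if i == 0%N then c 0%N * c0 else c i.
exists alpha; split.
  apply: (L2T_cvg_ae _ _ Lf _ cf).
  - by move=> n; exact: L2T_sum.
  - by move=> n; exact: L2T_affine.
  - near=> n; have n0 : (0 < n)%N by near: n; exact: nbhs_infty_gt.
    apply: filterS nu0 => x nu0x.
    rewrite big_ltn// nu0x /alpha /=; congr (_ + _).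
    by rewrite !big_add1 /= -?big_add1; apply: eq_bigr.
have [C HC] := HWV_lambda_bounded Hf.
have t0 i : (0 <= i)%N -> true -> (0 <= (lambda i * alpha i ^+ 2)%:E)%E.
  by move=> _ _; rewrite lee_fin mulr_ge0 ?lambda_ge0 ?sqr_ge0.
apply: (@le_lt_trans _ _ C%:E); last exact: ltry.
apply: lime_le; first by apply: is_cvg_nneseries => i _ _; exact: t0.
near=> n; have n0 : (0 < n)%N by near: n; exact: nbhs_infty_gt.
rewrite sumEFin lee_fin (le_trans _ (HC n))// [leRHS]big_ltn// l0 mul0r add0r.
rewrite le_eqVlt; apply/orP; left; apply/eqP.
apply: eq_big_nat => i /andP[i1 _]; rewrite cE /alpha.
by case: eqP i1 => // ->.
Unshelve. all: by end_near. Qed.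

Lemma smooth_eigenbasis : exists nu' : nat -> R -> R, forall i,
  [/\ frakD W V (nu' i), {ae restrT dV, forall x, nu i x = nu' i x} &
      DD (nu' i) = fun x => - lambda i * nu' i x].
Proof.
have [_ eig _ _ _] := nuP.
suff /choice[nu' nu'P] : forall i, exists f', [/\ frakD W V f',
    {ae restrT dV, forall x, nu i x = f' x} & DD f' = fun x => - lambda i * f' x].
  by exists nu'.
move=> i; have [f' [h1 h2 h3]] := laplacian_eigen_frakD W_incr V_incr W_cadlag
  V_caglad W_per V_per W0 dWE dVE (eig i).
by exists f'; split => //; exact/funext.
Qed.

(** * Partial sums of everywhere differentiable eigenfunctions *)

Section smooth.
Context (nu' : nat -> R -> R).
Hypothesis nu'P : forall i,
  [/\ frakD W V (nu' i), {ae restrT dV, forall x, nu i x = nu' i x} &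
      DD (nu' i) = fun x => - lambda i * nu' i x].

Lemma frakD_sum a (c : nat -> R) m n :
  frakD W V (fun x => a + \sum_(m <= i < n) c i * nu' i x) /\
  DD (fun x => a + \sum_(m <= i < n) c i * nu' i x) =
    (fun x => \sum_(m <= i < n) (- lambda i * c i) * nu' i x).
Proof.
elim: (index_iota m n) => [|i s [IH1 IH2]].
  rewrite (_ : (fun x => a + _) = fun=> a); last first.
    by apply/funext => x; rewrite big_nil addr0.
  have [h ->] := frakD_cst W V a; split => //.
  by apply/funext => x; rewrite big_nil.
have [Di _ Ei] := nu'P i.
have [h1 h2] := frakD_lin (c i) Di IH1.
rewrite (_ : (fun x => a + _) = fun x => c i * nu' i x +
    (a + \sum_(j <- s) c j * nu' j x)); last first.
  by apply/funext => x; rewrite big_cons addrCA.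
split => //; rewrite h2 IH2 Ei; apply/funext => x; rewrite big_cons.
by congr (_ + _); ring.
Qed.

(** The double derivative acts diagonally on the [nu' i], and inner products see only a.e. classes,
    so the orthonormality of [nu] applies. *)
Lemma norm12_sum (c : nat -> R) m n :
  norm12 W V dV (fun x => \sum_(m <= i < n) c i * nu' i x) ^+ 2 =
  \sum_(m <= i < n) (1 + lambda i) * c i ^+ 2.
Proof.
have L' i : L2T dV (nu' i) by have [/frakD_L2T[]] := nu'P i.
have nn' i : {ae restrT dV, forall x, nu' i x = nu i x}.
  by have [_ h _] := nu'P i; apply: filterS h => x ->.
have [_] := frakD_sum 0 c m n.
rewrite (_ : (fun x => 0 + _) = fun x => \sum_(m <= i < n) c i * nu' i x); last first.
  by apply/funext => x; rewrite add0r.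
rewrite /norm12 => ->.
rewrite (_ : _ \- _ = fun x => \sum_(m <= i < n) ((1 + lambda i) * c i) * nu' i x);
  last first.
  by apply/funext => x; rewrite /= -sumrB; apply: eq_bigr => i _; ring.
have -> : <|(fun x => \sum_(m <= i < n) ((1 + lambda i) * c i) * nu' i x),
            (fun x => \sum_(m <= i < n) c i * nu' i x)|> =
          \sum_(m <= i < n) (1 + lambda i) * c i ^+ 2.
  transitivity (<|(fun x => \sum_(m <= i < n) ((1 + lambda i) * c i) * nu i x),
            (fun x => \sum_(m <= i < n) c i * nu i x)|>).
    by apply: innerT_ae; (try exact: L2T_sum); exact: ae_eq_sum.
  rewrite innerT_suml//; last exact: L2T_sum.
  apply: eq_big_nat => i imn; rewrite innerTC innerT_sum_basis// imn.
  by rewrite expr2 mulrA.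
rewrite sqr_sqrtr// sumr_ge0// => i _; rewrite mulr_ge0 ?sqr_ge0//.
by rewrite addr_ge0 ?lambda_ge0.
Qed.

Lemma cauchy12_sum (alpha : nat -> R) :
  (\sum_(1 <= i <oo) (lambda i * alpha i ^+ 2)%:E < +oo)%E ->
  cauchy12 W V dV (fun n x => alpha 0%N + \sum_(1 <= i < n) alpha i * nu' i x).
Proof.
move=> soo; have [_ _ _ _ [_ loo]] := nuP.
pose T n := \sum_(1 <= i < n) lambda i * alpha i ^+ 2.
have t0 i : 0 <= lambda i * alpha i ^+ 2 by rewrite mulr_ge0 ?lambda_ge0 ?sqr_ge0.
have ndT : nondecreasing_seq T.
  apply/nondecreasing_seqP => -[|n]; first by rewrite /T !big_geq.
  by rewrite /T [leRHS]big_nat_recr//= lerDl.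
have Tub n : T n <= fine (\sum_(1 <= i <oo) (lambda i * alpha i ^+ 2)%:E)%E.
  rewrite -lee_fin fineK; last first.
    rewrite ge0_fin_numE//; apply: nneseries_ge0 => i _ _.
    by rewrite lee_fin.
  rewrite /T -sumEFin; apply: nneseries_lim_ge => i _ _.
  by rewrite lee_fin.
have cT : cvgn T.
  apply: nondecreasing_is_cvgn => //.
  by eexists => _ [n _ <-]; exact: Tub.
have TL n : T n <= limn T by exact: nondecreasing_cvgn_le.
have key e : 0 < e -> exists N : nat, forall n m, (N <= n)%N -> (n <= m)%N ->
    \sum_(n <= i < m) (1 + lambda i) * alpha i ^+ 2 < e ^+ 2.
  move=> e0.
  have e40 : 0 < e ^+ 2 / 4 by rewrite divr_gt0// exprn_gt0.
  (* Once [lambda i >= 1], the weight 1 + lambda_i is at most 2 lambda_i; a tail of [T] below e^2/4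
     then bounds the energy by e^2/2, strictly below e^2. *)
  have : \forall n \near \oo, limn T - T n <= e ^+ 2 / 4 /\ 1 <= lambda n /\ (1 <= n)%N.
    near=> n; split; last split.
    - apply: le_trans (ler_norm _) _; near: n.
      by move/cvgrPdist_le : cT; exact.
    - by near: n; move/cvgryPge : loo; exact.
    - by near: n; exact: nbhs_infty_ge.
  case=> N _ HN; exists N => n m Nn nm.
  have [hT [_ n1]] := HN n Nn.
  apply: (@le_lt_trans _ _ (2 * (T m - T n))).
    rewrite /T (@big_cat_nat _ _ _ n 1 m)//= addrAC subrr add0r mulr_sumr.
    rewrite big_nat [leRHS]big_nat; apply: ler_sum => i /andP[ni im].
    have [_ [l1 _]] := HN i (leq_trans Nn ni).
    by rewrite mulrA ler_wpM2r ?sqr_ge0//; lra.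
  have := TL m; have e2 : 0 < e ^+ 2 by rewrite exprn_gt0.
  lra.
(* The successor makes both indices at least 1, as needed to split sums that start at 1. The
   constant [alpha 0] cancels in the difference. *)
move=> e e0; have [N HN] := key e e0; exists N.+1 => m n Nm Nn.
have sq (h : R -> R) : norm12 W V dV h ^+ 2 < e ^+ 2 -> norm12 W V dV h < e.
  by rewrite ltr_pXn2r// ?nnegrE ?sqrtr_ge0// ltW.
have [nm|/ltnW mn] := leqP n m; apply: sq.
- rewrite (_ : _ \- _ = fun x => \sum_(n <= i < m) alpha i * nu' i x).
    by rewrite norm12_sum; apply: HN => //; exact: ltnW.
  apply/funext => x /=; rewrite (@big_cat_nat _ _ _ n 1 m)//=; [ring|exact: leq_trans Nn].
- rewrite (_ : _ \- _ = fun x => \sum_(m <= i < n) (- alpha i) * nu' i x).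
    rewrite norm12_sum; under eq_bigr do rewrite sqrrN.
    by apply: HN => //; exact: ltnW.
  apply/funext => x /=.
  have -> : \sum_(m <= i < n) - alpha i * nu' i x = - \sum_(m <= i < n) alpha i * nu' i x.
    by rewrite -sumrN; apply: eq_bigr => i _; rewrite mulNr.
  rewrite (@big_cat_nat _ _ _ m 1 n)//=; [ring|exact: leq_trans Nm].
Unshelve. all: by end_near. Qed.

End smooth.

(** Replacing [nu] by [nu'] changes each partial sum on a null set only, so the L^2 convergence is
    inherited by a sequence in [frakD]. *)
Lemma spectral_HWV f (alpha : nat -> R) : L2T dV f ->
  L2T_cvg dV (fun n x => alpha 0%N + \sum_(1 <= i < n) alpha i * nu i x) f ->
  (\sum_(1 <= i <oo) (lambda i * alpha i ^+ 2)%:E < +oo)%E -> HWV W V dV f.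
Proof.
move=> Lf af soo; have [nu' nu'P] := smooth_eigenbasis.
have L' i : L2T dV (nu' i) by have [/frakD_L2T[]] := nu'P i.
split => //; exists (fun n x => alpha 0%N + \sum_(1 <= i < n) alpha i * nu' i x); split.
- by move=> n; have [] := frakD_sum nu'P (alpha 0%N) alpha 1 n.
- apply: (L2T_cvg_ae _ _ Lf _ af).
  + by move=> n; exact: L2T_affine.
  + by move=> n; exact: L2T_affine.
  + apply: nearW => n.
    have nn' i : {ae restrT dV, forall x, nu i x = nu' i x} by have [] := nu'P i.
    by apply: filterS (ae_eq_sum alpha 1 n nn') => x ->.
- exact: cauchy12_sum.
Qed.

End spectral.

Theorem theorem1p4p7 (R : realType) (W V : R -> R)
  (W_incr : {homo W : x y / x < y}) (V_incr : {homo V : x y / x < y})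
  (W_cadlag : cadlag W) (V_caglad : caglad V)
  (W_per : periodic_increments W) (V_per : periodic_increments V)
  (W_cont0 : {for 0, continuous W}) (V_cont0 : {for 0, continuous V})
  (W0 : W 0 = 0) (V0 : V 0 = 0)
  (dW dV : {measure set R -> \bar R})
  (dWE : forall a b : R, a <= b -> dW `]a, b]%classic = (W b - W a)%:E)
  (dVE : forall a b : R, a <= b -> dV `[a, b[%classic = (V b - V a)%:E)
  (nu : nat -> R -> R) (lambda : nat -> R)
  (nuP : laplacian_eigenbasis W dW dV nu lambda) :
  HWV W V dV =
  [set f | L2T dV f /\
    exists alpha : nat -> R,
      L2T_cvg dV
        (fun n x => alpha 0%N + \sum_(1 <= i < n) alpha i * nu i x) f /\
      (\sum_(1 <= i <oo) (lambda i * alpha i ^+ 2)%:E < +oo)%E].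
Proof.
apply/seteqP; split => f.
- move=> Hf; split; first by case: Hf.
  exact: (HWV_spectral W_incr V_incr W_cadlag V_caglad W_per W0 dWE dVE nuP Hf).
- move=> [Lf [alpha [af soo]]].
  exact: (spectral_HWV W_incr V_incr W_cadlag V_caglad W_per V_per W0
    dWE dVE nuP Lf af soo).
Qed.
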